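(* Let $\Gamma$ be a nontrivial countable free group. Then any given probability $\Gamma$-space $(X,\mu)$ is orbit equivalent to actions of uncountably many pairwise non-isomorphic groups.
   Context: A probability $\Gamma$-space is a standard probability space $(X,\mu)$ with a measurable measure-preserving $\Gamma$-action that is essentially free (the stabiliser of almost every point is trivial); the actions in the conclusion are likewise essentially free measure-preserving actions of countable groups on standard probability spaces. Given a probability $\Gamma$-space $X$ and a probability $\Lambda$-space $Y$, the actions are orbit equivalent if there is an isomorphism of measure spaces (modulo null sets) $F:X\to Y$ with $F(\Gamma x)=\Lambda F(x)$ for a.e. $x\in X$. *)

(* Defs.v *)
From HB Require Import structures.
From mathcomp Require Import all_boot all_order all_algebra.
From mathcomp Require Import all_classical all_reals all_analysis.

Set Implicit Arguments.
Unset Strict Implicit.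
Unset Printing Implicit Defensive.

Local Open Scope classical_set_scope.

Definition group_isomorphic (G H : groupType) : Prop :=
  exists f : G -> H, bijective f /\ {morph f : x y / (x * y)%g}.

(* Words in the letters b and b^-1: (b, true) stands for b, (b, false) for
   b^-1.  The two are kept distinct even when b = b^-1 in G. *)
Definition letter_value (G : groupType) (l : G * bool) : G :=
  if l.2 then l.1 else (l.1)^-1%g.

Definition word_value (G : groupType) (w : seq (G * bool)) : G :=
  (\prod_(l <- w) letter_value l)%g.

Definition reduced (G : groupType) (w : seq (G * bool)) : bool :=
  sorted (fun l l' => (l.1 != l'.1) || (l.2 == l'.2)) w.

(* Evaluation is a bijection from the reduced words over B, i.e. from the free
   group on B, onto G. *)
Definition free_basis (G : groupType) (B : set G) : Prop :=
  forall g : G, exists! w : seq (G * bool),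
    [/\ reduced w, (forall l, l \in w -> B l.1) & word_value w = g].

Definition free_group (G : groupType) : Prop :=
  exists B : set G, free_basis B.

Definition polish (R : realType) (T : completePseudoMetricType R) : Prop :=
  hausdorff_space T /\ exists2 D : set T, countable D & dense D.

(* X is isomorphic, as a measurable space, to a Polish space with its Borel
   sigma-algebra. *)
Definition standard_borel (R : realType) (d : measure_display)
    (X : measurableType d) : Prop :=
  exists2 T : completePseudoMetricType R, polish T &
  exists2 f : X -> T, bijective f &
    forall A : set T, measurable (f @^-1` A) <-> <<s [set U | open U] >> A.

Record probability_action (R : realType) (G : groupType)
    (d : measure_display) (X : measurableType d) (mu : probability X R)
    (act : G -> X -> X) : Prop := {
  action_standard : standard_borel R X;
  action1 : forall x, act 1%g x = x;
  actionM : forall g h x, act (g * h)%g x = act g (act h x);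
  action_measurable : forall g, measurable_fun [set: X] (act g);
  action_preserving : forall g (A : set X),
    measurable A -> mu (act g @^-1` A) = mu A;
  action_ess_free : {ae mu, forall x, forall g, act g x = x -> g = 1%g} }.

Definition action_orbit (G : groupType) (X : Type) (act : G -> X -> X)
    (x : X) : set X := [set act g x | g in [set: G]].

(* F restricts to an isomorphism of measure spaces between conull measurable
   subsets; its values off X0 are irrelevant. *)
Definition isomorphism_mod_null (R : realType) (d d' : measure_display)
    (X : measurableType d) (Y : measurableType d')
    (mu : probability X R) (nu : probability Y R) (F : X -> Y) : Prop :=
  exists (X0 : set X) (Y0 : set Y),
    [/\ measurable X0 /\ measurable Y0,
        mu (~` X0) = 0%E /\ nu (~` Y0) = 0%E,
        set_bij X0 Y0 F,
        (forall B : set Y, B `<=` Y0 -> measurable B ->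
           measurable (X0 `&` F @^-1` B)) &
        (forall A : set X, A `<=` X0 -> measurable A ->
           measurable (F @` A) /\ nu (F @` A) = mu A)].

Definition orbit_equivalent (R : realType) (G H : groupType)
    (d d' : measure_display) (X : measurableType d) (Y : measurableType d')
    (mu : probability X R) (nu : probability Y R)
    (actX : G -> X -> X) (actY : H -> Y -> Y) : Prop :=
  exists2 F : X -> Y, isomorphism_mod_null mu nu F &
    {ae mu, forall x, F @` action_orbit actX x = action_orbit actY (F x)}.

(* Main.v *)
Require Import Defs.
From HB Require Import structures.
From mathcomp Require Import all_boot all_order all_algebra.
From mathcomp Require Import all_classical all_reals all_analysis.
From mathcomp Require Import zify ring lra.

Set Implicit Arguments.
Unset Strict Implicit.
Unset Printing Implicit Defensive.

Import Order.TTheory GRing.Theory Num.Theory.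

Local Open Scope classical_set_scope.
Local Open Scope ring_scope.

(** Fix a free basis B of Gamma and b0 in B, and let T be the transformation of
X given by b0.  Gamma is the free product of the cyclic group generated by b0
and the free group on the rest of B, and since the action is essentially free
its orbit relation is the corresponding free product of orbit relations.  The
cyclic factor can therefore be replaced by any group with an essentially free
action that has the same orbits as T almost everywhere: such a group and the
rest of B again generate a free product, with the same orbits as Gamma.  The
replacements are increasing unions of finite cyclic groups of orders N 0, N 1,
...; the primes that divide some N k are the prime orders of torsion elements
of the resulting group, and they can be prescribed.  There are uncountably
many choices of a set of primes.

The replacement is Dye's theorem for Z in a form that allows the orders to be
chosen along the way.  A sequence of markers (vanishing_markers), decreasing to
the empty set and met by every orbit infinitely often in both directions, cuts
the orbits of T into finite intervals that grow to the whole orbit.  A stage is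
an equivalence relation inside the orbits whose classes all have the same
number of elements, labelled bijectively and measurably.  To refine it, the
representatives of its classes are put into groups of exactly n elements,
inside longer and longer intervals and in the order of the orbit; fewer than n
representatives per interval are left over each time, so that by recurrence
almost nothing is left over in the end (all_grouped, next_stage_ok).  If n is
large and the first intervals are long, most consecutive points x, T x end up
in the same class: the obstructions are the ends of intervals, the last
elements of groups, whose mass is at most 1/n, and the short tails of intervals
(same_group_near, stage_step).  The labels of a stage define a transformation
tau k all of whose orbits have N k elements, tau k is a power of tau (k + 1),
and the orbits of the tau k exhaust those of T (zaction_rotations).

Lambda is the group of transformations of a conull invariant set generated by
the tau k and the elements of B other than b0.  Every element of Lambda has a
normal form, and at each point a normal form acts like a reduced word over B,
which is nonempty unless the normal form is; hence Lambda acts freely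
(normal_word_translation, generated_map_free).  A cyclically reduced normal
form of length at least two has infinite order, so every torsion element is
conjugate to a power of some tau k (generated_torsion). *)

(** * Discrete-valued measurable functions *)

Definition least (P : nat -> bool) : nat :=
  if pselect (exists n, P n) is left h then ex_minn h else 0%N.

Lemma leastP (P : nat -> bool) : (exists n, P n) -> P (least P).
Proof.
by move=> h; rewrite /least; case: pselect => // h'; case: ex_minnP.
Qed.

Lemma least_min (P : nat -> bool) n : P n -> (least P <= n)%N.
Proof.
move=> Pn; rewrite /least; case: pselect => // h.
by case: ex_minnP => m _; apply.
Qed.

Lemma least_notP (P : nat -> bool) n : (n < least P)%N -> ~~ P n.
Proof. by move=> nl; apply/negP => /least_min; rewrite leqNgt nl. Qed.

Lemma leastE (P : nat -> bool) n :
  P n -> (forall m, (m < n)%N -> ~~ P m) -> least P = n.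
Proof.
move=> Pn nP; apply/eqP; rewrite eqn_leq least_min //= leqNgt.
by apply/negP => /nP /negP; apply; apply: leastP; exists n.
Qed.

Section DiscreteMeasurability.
Context {d : measure_display} {X : measurableType d}.

(** Every construction below produces, at a point x, integers or finite sequences
that say how far to move along the orbit of x.  Measurability is only ever
needed for such discrete codes. *)
Definition discretely_measurable (K : Type) (k : X -> K) : Prop :=
  forall A : set K, measurable (k @^-1` A).
Local Notation dm := discretely_measurable.

Lemma measurable_exists (I : countType) (P : I -> X -> Prop) :
  (forall i, measurable [set x | P i x]) ->
  measurable [set x | exists i, P i x].
Proof.
move=> mP; rewrite (_ : [set x | _] = \bigcup_i [set x | P i x]).
  exact: countable_bigcupT_measurable.
by apply/seteqP; split=> x [i]; [exists i | move=> _ ?; exists i].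
Qed.

Lemma measurable_forall (I : countType) (P : I -> X -> Prop) :
  (forall i, measurable [set x | P i x]) ->
  measurable [set x | forall i, P i x].
Proof.
move=> mP; rewrite (_ : [set x | _] = ~` [set x | exists i, ~ P i x]).
  apply/measurableC/measurable_exists => i.
  by rewrite (_ : [set x | _] = ~` [set x | P i x])//; exact: measurableC.
apply/seteqP; split=> x /=; first by move=> h [i]; apply.
by move=> h i; apply: contrapT => h'; apply: h; exists i.
Qed.

Lemma dm_fibers (K : countType) (k : X -> K) :
  (forall a, measurable [set x | k x = a]) -> dm k.
Proof.
move=> mk A.
rewrite (_ : _ @^-1` _ = [set x | exists a, A a /\ k x = a]); last first.
  by apply/seteqP; split=> x /=; [exists (k x) | move=> [a [Aa ->]]].
apply: measurable_exists => a; have [Aa|nAa] := pselect (A a).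
  by rewrite (_ : [set x | _] = [set x | k x = a])//; apply/seteqP; split=> x //= [].
by rewrite (_ : [set x | _] = set0)//; apply/seteqP; split=> x //= [].
Qed.

Lemma dm_cst (K : Type) (a : K) : dm (fun _ => a).
Proof.
by move=> A; rewrite preimage_cst; case: ifP => _.
Qed.

Lemma dm_comp (K L : Type) (h : K -> L) (k : X -> K) : dm k -> dm (fun x => h (k x)).
Proof. by move=> mk A; exact: (mk (h @^-1` A)). Qed.

(** The value of F may depend on the point as well as on the code, since the
fibers of the code are countably many measurable sets. *)
Lemma dm_bind (K : countType) (L : Type) (k : X -> K) (F : K -> X -> L) :
  dm k -> (forall a, dm (F a)) -> dm (fun x => F (k x) x).
Proof.
move=> mk mF A.
rewrite (_ : _ @^-1` _ =
    [set x | exists a, (k @^-1` [set a] `&` F a @^-1` A) x]).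
  by apply: measurable_exists => a; apply: measurableI; [exact: mk | exact: mF].
by apply/seteqP; split=> x /=; [exists (k x) | move=> [a [-> ]]].
Qed.

Lemma dm_comp2 (K L : countType) (M : Type) (h : K -> L -> M)
    (k : X -> K) (l : X -> L) : dm k -> dm l -> dm (fun x => h (k x) (l x)).
Proof.
move=> mk ml; apply: (dm_bind (F := fun a x => h a (l x)) mk) => a.
exact: dm_comp.
Qed.

Lemma dm_asbool (A : set X) : measurable A -> dm (fun x => `[< A x >]).
Proof.
move=> mA; apply: dm_fibers => -[].
  by rewrite (_ : [set x | _] = A)//; apply/seteqP; split=> x /=; move/asboolP.
rewrite (_ : [set x | _] = ~` A); first exact: measurableC.
apply/seteqP; split=> x /=; first by move/asboolPn.
by move=> nA; apply/asboolPn.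
Qed.

Lemma dm_measurable (P : X -> bool) : dm P -> measurable [set x | P x].
Proof. by move=> mP; exact: (mP [set true]). Qed.

Lemma dm_exists (I : countType) (P : I -> X -> bool) :
  (forall i, dm (P i)) -> dm (fun x => `[< exists i, P i x >]).
Proof.
by move=> mP; apply/dm_asbool/measurable_exists => i; exact/dm_measurable/mP.
Qed.

Lemma dm_least (P : nat -> X -> bool) :
  (forall n, dm (P n)) -> dm (fun x => least (P ^~ x)).
Proof.
move=> mP; apply: dm_fibers => n.
pose Q n x := [forall i : 'I_n, ~~ P i x].
have mQ m : dm (Q m).
  rewrite (_ : Q m = fun x => `[< forall i : 'I_m, ~~ P i x >]).
    apply/dm_asbool/measurable_forall => i; apply: dm_measurable.
    by apply: dm_comp; exact: mP.
  by apply/funext => x; apply/forallP/asboolP.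
pose ex x := `[< exists n, P n x >].
have mex : dm ex by exact: dm_exists.
rewrite (_ : [set x | _] = [set x | if ex x then P n x && Q n x else n == 0%N]).
  apply: dm_measurable.
  have m2 := dm_comp2 (fun a b => a && b) (mP n) (mQ n).
  exact: (dm_comp2 (fun (a b : bool) => if a then b else n == 0%N) mex m2).
apply/seteqP; split=> x /=.
  rewrite /ex; case: asboolP => [e <-|ne <-].
    rewrite (leastP e) /=; apply/forallP => i.
    exact: (@least_notP (P ^~ x) _ (ltn_ord i)).
  by rewrite /least; case: pselect.
rewrite /ex; case: asboolP => [e /andP[Pn /forallP Qn]|ne /eqP ->].
  by apply: leastE => // m mn; exact: (Qn (Ordinal mn)).
by rewrite /least; case: pselect.
Qed.

Lemma dm_filter (I : Type) (P : I -> X -> bool) (s : seq I) :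
  (forall i, dm (P i)) -> dm (fun x => [seq i <- s | P i x]).
Proof.
move=> mP; elim: s => [|i s IH] /=; first exact: dm_cst.
move=> A.
rewrite (_ : _ @^-1` _ =
   ([set x | P i x] `&` (fun x => [seq i <- s | P i x]) @^-1` (fun t => A (i :: t)))
   `|` (~` [set x | P i x] `&` (fun x => [seq i <- s | P i x]) @^-1` A)).
  apply: measurableU; apply: measurableI; rewrite ?IH//.
    exact: dm_measurable.
  exact/measurableC/dm_measurable.
apply/seteqP; split=> x /=; first by case: ifP => Pi ?; [left|right].
by case: ifP => Pi [] [].
Qed.

(** Taking the first code in a fixed enumeration makes the choice measurable. *)
Definition find_code (K : countType) (k0 : K) (Q : K -> X -> bool) (x : X) : K :=
  odflt k0 (unpickle (least (fun m => if unpickle m is Some k then Q k x else false))).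

Lemma find_codeP (K : countType) (k0 : K) (Q : K -> X -> bool) (x : X) :
  (exists k, Q k x) -> Q (find_code k0 Q x) x.
Proof.
move=> [k Qk]; rewrite /find_code.
have := @leastP (fun m => if unpickle m is Some k then Q k x else false).
case: unpickle => [k'|] /= h; first by apply: h; exists (pickle k); rewrite pickleK.
by have : false by apply: h; exists (pickle k); rewrite pickleK.
Qed.

Lemma dm_find_code (K : countType) (k0 : K) (Q : K -> X -> bool) :
  (forall k, dm (Q k)) -> dm (find_code k0 Q).
Proof.
move=> mQ; apply: (dm_comp (fun m => odflt k0 (unpickle m))); apply: dm_least => n.
by case: unpickle => [k|]; [exact: mQ | exact: dm_cst].
Qed.

End DiscreteMeasurability.

Notation dm := discretely_measurable.

(** * Masses in a probability space *)

Section RealMeasure.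
Context {R : realType} {d : measure_display} {X : measurableType d}.
Context (mu : probability X R).

Definition mass (A : set X) : R := fine (mu A).

Lemma massE A : measurable A -> mu A = (mass A)%:E.
Proof. by move=> mA; rewrite /mass fineK// fin_num_measure. Qed.

Lemma mass_ge0 A : 0 <= mass A.
Proof. by rewrite /mass fine_ge0. Qed.

Lemma mass_le A B : measurable A -> measurable B -> A `<=` B -> mass A <= mass B.
Proof.
move=> mA mB AB; rewrite -lee_fin -!massE//.
by apply: le_measure => //; rewrite inE.
Qed.

Lemma mass_le1 A : measurable A -> mass A <= 1.
Proof. by move=> mA; rewrite -lee_fin -massE//; exact: probability_le1. Qed.

Lemma massU A B : measurable A -> measurable B -> mass (A `|` B) <= mass A + mass B.
Proof.
move=> mA mB; rewrite -lee_fin EFinD -!massE//; last exact: measurableU.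
exact: measureU2.
Qed.

Lemma mass_exists_seq (I : eqType) (F : I -> set X) (s : seq I) (c : R) :
  (forall i, measurable (F i)) -> (forall i, mass (F i) <= c) ->
  measurable [set x | exists2 i, i \in s & F i x] /\
  mass [set x | exists2 i, i \in s & F i x] <= (size s)%:R * c.
Proof.
move=> mF Fc; elim: s => [|i s [IHm IH]] /=.
  rewrite (_ : [set x | _] = set0); last by apply/seteqP; split=> x //= [].
  by split=> //; rewrite mul0r /mass measure0.
rewrite (_ : [set x | _] = F i `|` [set x | exists2 i, i \in s & F i x]).
  split; first exact: measurableU.
  apply: le_trans (massU _ _) _ => //.
  by rewrite -natr1 mulrDl mul1r addrC lerD.
apply/seteqP; split=> x /=.
  by move=> [j]; rewrite inE => /predU1P[->|js] Fj; [left|right; exists j].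
move=> [Fi|[j js Fj]]; first by exists i; rewrite ?mem_head.
by exists j => //; rewrite inE js orbT.
Qed.

(** Used in two ways: as an upper bound for a when n is fixed, and, for all n at
once, to show that a set with infinitely many disjoint translates is null. *)
Lemma mass_disjoint (F : nat -> set X) (n : nat) (a : R) :
  (forall i, measurable (F i)) ->
  (forall i j x, (i < n)%N -> (j < n)%N -> F i x -> F j x -> i = j) ->
  (forall i, (i < n)%N -> a <= mass (F i)) -> n%:R * a <= 1.
Proof.
move=> mF dF aF.
have mU : measurable (\big[setU/set0]_(i < n) F i) by exact: bigsetU_measurable.
apply: le_trans (mass_le1 mU).
have tF : trivIset setT (fun i : 'I_n => F i).
  move=> i j _ _ [x [Fi Fj]]; apply: val_inj.
  exact: (dF _ _ x (ltn_ord i) (ltn_ord j)).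
rewrite -lee_fin -massE// (measure_semi_additive_ord mu (fun i => mF i) tF mU).
rewrite (eq_bigr (fun i : 'I_n => (mass (F i))%:E)) => [|i _]; last exact: massE.
rewrite sumEFin lee_fin mulr_natl -[n in _ *+ n]card_ord -sumr_const.
by apply: ler_sum => i _; exact: aF.
Qed.

Definition conull (Y : set X) : Prop := measurable Y /\ mu (~` Y) = 0%E.

Lemma mass0P A : measurable A -> mu A = 0%E <-> mass A = 0.
Proof. by move=> mA; rewrite massE//; split=> [[->]|->]. Qed.

Lemma null_le A B : measurable A -> measurable B -> A `<=` B -> mu B = 0%E -> mu A = 0%E.
Proof.
move=> mA mB AB /mass0P -/(_ mB) B0; apply/mass0P => //; apply/eqP.
by rewrite eq_le mass_ge0 andbT -B0 mass_le.
Qed.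

Lemma conull_forall (I : countType) (F : I -> set X) :
  (forall i, conull (F i)) -> conull [set x | forall i, F i x].
Proof.
move=> cF; split; first by apply: measurable_forall => i; exact: (cF i).1.
pose G n x := if unpickle n is Some i then ~ F i x else False.
have mG n : measurable [set x | G n x].
  rewrite /G; case: unpickle => [i|]; last first.
    by rewrite (_ : [set x | _] = set0).
  by rewrite (_ : [set x | _] = ~` F i)//; apply: measurableC; exact: (cF i).1.
rewrite (_ : ~` _ = \bigcup_n [set x | G n x]); last first.
  apply/seteqP; split=> x /=.
    move=> /existsNP[i nF]; exists (pickle i) => //=.
    by rewrite /G pickleK.
  by move=> [n _ /=]; rewrite /G; case: unpickle => // i nF h; apply: nF.
apply/eqP; rewrite eq_le measure_ge0 andbT.
apply: le_trans (generalized_Boole_inequality _ _ _) _ => //.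
  exact: bigcupT_measurable.
rewrite eseries0// => n _ _; rewrite /G; case: unpickle => [i|].
  by rewrite -[RHS](cF i).2.
by rewrite (_ : [set x | _] = set0)// measure0.
Qed.

Lemma conullI A B : conull A -> conull B -> conull (A `&` B).
Proof.
move=> cA cB; have := @conull_forall bool (fun b => if b then A else B).
rewrite (_ : [set x | _] = A `&` B).
  by apply; case.
apply/seteqP; split=> x /=; first by move=> h; split; [exact: (h true)|exact: (h false)].
by move=> [Ax Bx] [].
Qed.

Lemma mass_le_conull Y A B : conull Y -> measurable A -> measurable B ->
  A `&` Y `<=` B -> mass A <= mass B.
Proof.
move=> [mY Y0] mA mB AB.
have mYC := measurableC mY.
have : mass A <= mass (B `|` ~` Y).
  apply: mass_le => //; first exact: measurableU.
  by move=> x Ax; have [Yx|] := pselect (Y x); [left; exact: AB|right].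
move=> /le_trans; apply; apply: le_trans (massU mB mYC) _.
by rewrite (_ : mass (~` Y) = 0) ?addr0//; apply/mass0P.
Qed.

(** Continuity from above, applied to the unions of the tails of A. *)
Lemma eventually_small (Y : set X) (A : nat -> set X) (eps : R) :
  conull Y -> (forall n, measurable (A n)) ->
  (forall x, Y x -> exists J, forall j, (J <= j)%N -> ~ A j x) ->
  0 < eps -> exists J, forall j, (J <= j)%N -> mass (A j) < eps.
Proof.
move=> cY mA evA e0.
pose B J := [set x | exists j, (J <= j)%N /\ A j x].
have mB J : measurable (B J).
  apply: measurable_exists => j; have [Jj|nJj] := boolP (J <= j)%N.
    by rewrite (_ : [set x | _] = A j)//; apply/seteqP; split=> x //= [].
  by rewrite (_ : [set x | _] = set0)//; apply/seteqP; split=> x //= [].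
have mI : measurable (\bigcap_n B n) by exact: bigcapT_measurable.
have I0 : mu (\bigcap_n B n) = 0%E.
  apply: null_le cY.2 => //; first exact/measurableC/cY.1.
  move=> x Bx Yx; have [J hJ] := evA _ Yx.
  by have [j [/hJ]] := Bx J I.
have cv : mu \o B @ \oo --> mu (\bigcap_n B n).
  apply: nonincreasing_cvg_mu => //.
    by apply: le_lt_trans (probability_le1 _ (mB 0%N)) _; rewrite ltry.
  apply/nonincreasing_seqP => n; apply/subsetPset => x [j [nj Aj]].
  by exists j; split => //; exact: ltnW.
rewrite I0 in cv.
have := cv [set y | (y < eps%:E)%E] _.
have : nbhs (0%E : \bar R) [set y | (y < eps%:E)%E].
  by apply: open_nbhs_nbhs; split; [exact: open_ereal_lt_ereal|rewrite /= lte_fin].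
move=> h /(_ h) [J _ hJ]; exists J => j Jj.
apply: le_lt_trans (_ : mass (B J) < eps).
  by apply: mass_le => // x Aj; exists j.
have := hJ J (leqnn J) => /=; by rewrite massE// lte_fin.
Qed.

End RealMeasure.

(** * Measure preserving actions of the integers *)

Record zaction (R : realType) (d : measure_display) (X : measurableType d)
    (mu : probability X R) (sh : int -> X -> X) : Prop := {
  sh0 : forall x, sh 0 x = x;
  shD : forall i j x, sh (i + j) x = sh i (sh j x);
  sh_measurable : forall i A, measurable A -> measurable (sh i @^-1` A);
  sh_preserving : forall i A, measurable A -> mu (sh i @^-1` A) = mu A }.

Section ZAction.
Context {R : realType} {d : measure_display} {X : measurableType d}.
Context {mu : probability X R} {sh : int -> X -> X} (zsh : zaction mu sh).

Local Notation mass := (mass mu).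

Lemma shK i : cancel (sh i) (sh (- i)).
Proof. by move=> x; rewrite -(shD zsh) addNr (sh0 zsh). Qed.

Lemma shNK i : cancel (sh (- i)) (sh i).
Proof. by move=> x; rewrite -(shD zsh) subrr (sh0 zsh). Qed.

Lemma dm_sh (K : Type) (k : X -> K) i : dm k -> dm (fun x => k (sh i x)).
Proof. by move=> mk A; exact: (sh_measurable zsh i (mk A)). Qed.

Lemma dm_sh_bind (K : Type) (k : X -> K) (t : X -> int) :
  dm k -> dm t -> dm (fun x => k (sh (t x) x)).
Proof.
by move=> mk mt; apply: (dm_bind (F := fun i x => k (sh i x))) => // i; exact: dm_sh.
Qed.

Definition shift_invariant (Y : set X) : Prop := forall i x, Y x -> Y (sh i x).

(** The largest invariant subset of Y. *)
Definition orbitwise (Y : set X) : set X := [set x | forall i, Y (sh i x)].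

Lemma mass_sh i A : measurable A -> mass (sh i @^-1` A) = mass A.
Proof. by move=> mA; rewrite /mass (sh_preserving zsh). Qed.

Lemma orbitwise_conull Y : conull mu Y -> conull mu (orbitwise Y).
Proof.
move=> [mY Y0]; apply: conull_forall => i; split; first exact: (sh_measurable zsh).
rewrite -[RHS]Y0 -[RHS](sh_preserving zsh i)//; exact: measurableC.
Qed.

Lemma orbitwise_invariant Y : shift_invariant (orbitwise Y).
Proof. by move=> i x Yx j; rewrite -(shD zsh). Qed.

(** Mass transport.  A splits into countably many pieces on which the map is a
single power of the action, so that it preserves measure there; by injectivity
the images of the pieces are disjoint subsets of B. *)
Lemma mass_transport (A B : set X) (t : X -> int) :
  measurable A -> measurable B -> dm t ->
  (forall x, A x -> B (sh (t x) x)) ->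
  (forall x y, A x -> A y -> sh (t x) x = sh (t y) y -> x = y) ->
  mass A <= mass B.
Proof.
move=> mA mB mt AB inj.
(* D n is the piece of A that moves by the shift with code n, E n its image;
pickle_inv rather than unpickle makes different codes stand for different
shifts. *)
pose D n : set X := if pickle_inv n is Some i then A `&` t @^-1` [set i] else set0.
pose E n : set X := if pickle_inv n is Some i then sh (- i) @^-1` (D n) else set0.
have mD n : measurable (D n).
  by rewrite /D; case: pickle_inv => // i; apply: measurableI => //; exact: mt.
have mE n : measurable (E n).
  by rewrite /E; case: pickle_inv => // i; exact: (sh_measurable zsh).
have DE n : mu (E n) = mu (D n).
  rewrite /E /D; case: pickle_inv => // i; rewrite (sh_preserving zsh)//.
  by apply: measurableI => //; exact: mt.
have DP n y : D n y <-> A y /\ n = pickle (t y).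
  have := @pickleK_inv int (t y); have := @pickle_invK int n; rewrite /D.
  case ni: (pickle_inv n) => [i|] /= pi ty.
    by rewrite -pi; split=> [[Ay /= <-]|[Ay /(pcan_inj pickleK) ->]].
  by split=> [[]|[Ay nE]]; rewrite -nE ni in ty.
have EP n x : E n x -> exists2 y, A y /\ n = pickle (t y) & x = sh (t y) y.
  move=> Enx; suff [i ni Dn] : exists2 i, pickle_inv n = Some i & D n (sh (- i) x).
    exists (sh (- i) x); first exact/DP.
    move: Dn => /DP[_ nE]; have := pickleK_inv (t (sh (- i) x)).
    by rewrite -nE ni => -[<-]; rewrite shNK.
  by move: Enx; rewrite /E; case: pickle_inv => // i Di; exists i.
have DA : A = \bigcup_n D n.
  apply/seteqP; split=> x; last by move=> [n _ /DP[]].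
  by move=> Ax; exists (pickle (t x)) => //; apply/DP.
have tD : trivIset setT D.
  by move=> i j _ _ [x [/DP[_ ->] /DP[_ ->]]].
have tE : trivIset setT E.
  move=> i j _ _ [x [/EP[y [Ay iE] ->] /EP[z [Az jE] /inj yz]]].
  by rewrite iE jE yz.
have mU : measurable (\bigcup_n E n) by exact: bigcupT_measurable.
suff -> : mass A = mass (\bigcup_n E n).
  by apply: mass_le => // x [n _ /EP[y [Ay _] ->]]; exact: AB.
rewrite /mass DA !measure_semi_bigcup//; last by rewrite -DA.
by congr fine; apply: eq_eseriesr => n _; exact/esym/DE.
Qed.

End ZAction.
Arguments shift_invariant {d X} sh Y.
Arguments orbitwise {d X} sh Y.

(** * Recurrence and vanishing markers *)

Section Recurrence.
Context {R : realType} {d : measure_display} {X : measurableType d}.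
Context {mu : probability X R} {sh : int -> X -> X} (zsh : zaction mu sh).

Definition ample (Y : set X) : Prop := conull mu Y /\ shift_invariant sh Y.

Lemma ampleI A B : ample A -> ample B -> ample (A `&` B).
Proof.
move=> [cA iA] [cB iB]; split; first exact: conullI.
by move=> i x [Ax Bx]; split; [exact: iA|exact: iB].
Qed.

Lemma ample_forall (I : countType) (F : I -> set X) :
  (forall i, ample (F i)) -> ample [set x | forall i, F i x].
Proof.
move=> aF; split; first by apply: conull_forall => i; exact: (aF i).1.
by move=> i x Fx j; apply: (aF j).2.
Qed.

Lemma zaction_opp : zaction mu (fun i => sh (- i)).
Proof.
split.
- by move=> x; rewrite oppr0 (sh0 zsh).
- by move=> i j x; rewrite opprD (shD zsh).
- by move=> i A; exact: (sh_measurable zsh).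
- by move=> i A; exact: (sh_preserving zsh).
Qed.

(** The points of W that never return to W have disjoint translates. *)
Lemma conull_return (W : set X) : measurable W ->
  conull mu [set x | W x -> exists n : nat, W (sh n.+1%:Z x)].
Proof.
move=> mW.
have mE : measurable [set x | exists n : nat, W (sh n.+1%:Z x)].
  by apply: measurable_exists => n; exact: (sh_measurable zsh).
pose L := W `&` ~` [set x | exists n : nat, W (sh n.+1%:Z x)].
have mL : measurable L by apply: measurableI => //; exact: measurableC.
have EL : [set x | W x -> exists n : nat, W (sh n.+1%:Z x)] = ~` L.
  apply/seteqP; split=> x /=; first by move=> h [Wx /=]; apply; exact: h.
  by move=> nL Wx; apply: contrapT => h; apply: nL.
rewrite EL; split; first exact: measurableC.
rewrite setCK; apply/mass0P => //.
have bound n : n%:R * mass mu L <= 1.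
  apply: (@mass_disjoint _ _ _ mu (fun i => sh i%:Z @^-1` L)).
  - by move=> i; exact: (sh_measurable zsh).
  - have lt i j x : (i < j)%N -> L (sh i%:Z x) -> L (sh j%:Z x) -> False.
      move=> ij [_ h] [Wj _]; apply: h; exists (j - i).-1.
      rewrite -(shD zsh); congr (W (sh _ x)): Wj; lia.
    move=> i j x _ _ Li Lj; have [ij|ji|//] := ltngtP i j.
      by case: (lt i j x ij Li Lj).
    by case: (lt j i x ji Lj Li).
  - by move=> i _; rewrite (mass_sh zsh i mL).
apply/eqP; rewrite eq_le mass_ge0 andbT leNgt; apply/negP => L0.
have [n hn] : exists n : nat, (mass mu L)^-1 < n%:R.
  by exists (Num.truncn (mass mu L)^-1).+1; rewrite truncnS_gt// invr_ge0 ltW.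
have := bound n; rewrite leNgt => /negP; apply.
by rewrite -ltr_pdivrMr// mul1r.
Qed.

(** Poincare recurrence, iterated along the orbit.  The set Y is invariant, so that
the conclusion may be used at every point of the orbit. *)
Lemma forward_recurrence (W : set X) : measurable W ->
  exists Y, ample Y /\ forall x, Y x -> W x ->
    forall k : int, exists2 j, k <= j & W (sh j x).
Proof.
move=> mW; have cW := conull_return mW.
exists (orbitwise sh [set x | W x -> exists n : nat, W (sh n.+1%:Z x)]).
split; first by split; [exact: (orbitwise_conull zsh)|exact: (orbitwise_invariant zsh)].
move=> x Yx Wx k.
have step (n : nat) : exists2 j, n%:Z <= j & W (sh j x).
  elim: n => [|n [j nj Wj]]; first by exists 0; rewrite ?(sh0 zsh).
  have [m Wm] := Yx j Wj; exists (m.+1%:Z + j); last by rewrite (shD zsh).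
  lia.
have [j kj Wj] := step `|k|%N; exists j => //; lia.
Qed.
End Recurrence.
Arguments ample {R d X} mu sh Y.

Section Markers.
Context {R : realType} {d : measure_display} {X : measurableType d}.
Context {mu : probability X R} {sh : int -> X -> X} (zsh : zaction mu sh).

Lemma recurrence (W : set X) : measurable W ->
  exists Y, ample mu sh Y /\ forall x, Y x -> W x ->
    forall k : int, (exists2 j, k <= j & W (sh j x)) /\
                    (exists2 j, j <= k & W (sh j x)).
Proof.
move=> mW; have [Y [aY hY]] := forward_recurrence zsh mW.
have [Z [[cZ iZ] hZ]] := forward_recurrence (zaction_opp zsh) mW.
exists (Y `&` Z); split.
  apply: ampleI => //; split=> // i x Zx.
  by rewrite -[i]opprK; exact: iZ.
move=> x [Yx Zx] Wx k; split; first exact: hY.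
by have [j kj Wj] := hZ x Zx Wx (- k); exists (- j); [lia|].
Qed.

Context (U : nat -> set X).

(** Step n keeps, on each orbit, the points inside U n if there are any, and all
points otherwise.  So no orbit is ever lost, and two points of one orbit are
told apart by some U n and cannot both survive. *)
Fixpoint marker (n : nat) : set X :=
  if n is n'.+1 then
    let V := marker n' `&` U n' in
    V `|` (marker n' `&` ~` [set x | exists i : int, V (sh i x)])
  else setT.

Lemma marker_measurable : (forall n, measurable (U n)) -> forall n, measurable (marker n).
Proof.
move=> mU; elim=> [|n IH] //=.
have mV : measurable (marker n `&` U n) by exact: measurableI.
apply: measurableU => //; apply: measurableI => //; apply: measurableC.
by apply: measurable_exists => i; exact: (sh_measurable zsh i mV).
Qed.

Lemma markerS n : marker n.+1 `<=` marker n.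
Proof. by move=> x /= [[]|[]]. Qed.

Lemma marker_meets n x : exists i, marker n (sh i x).
Proof.
elim: n => [|n [i IH]]; first by exists 0.
have [[j Vj]|nV] :=
    pselect (exists j, (marker n `&` U n) (sh j x)); first by exists j; left.
exists i; right; split => // -[j]; rewrite -(shD zsh) => Vj.
by apply: nV; exists (j + i).
Qed.

Lemma marker_cap x i :
  (forall y z, (forall n, U n y <-> U n z) -> y = z) ->
  (forall n, marker n x) -> (forall n, marker n (sh i x)) -> sh i x = x.
Proof.
move=> sepU; have key y j n :
    (forall n, marker n y) -> (forall n, marker n (sh j y)) -> U n y -> U n (sh j y).
  move=> my mj Un; have [[]//|[_ /=]] := mj n.+1; case.
  exists (- j); rewrite (shK zsh); split=> //; exact: my.
move=> mx mi; apply: sepU => n; split; last exact: key.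
by move=> /(key _ (- i) n mi); rewrite (shK zsh); apply.
Qed.

(** The intersection of the markers has at most one point on each orbit, and by
recurrence almost every orbit that meets it meets it twice. *)
Lemma vanishing_markers (X0 : set X) :
  (forall n, measurable (U n)) ->
  (forall y z, (forall n, U n y <-> U n z) -> y = z) ->
  ample mu sh X0 -> (forall x i, X0 x -> sh i x = x -> i = 0) ->
  exists Y, [/\ ample mu sh Y, Y `<=` X0,
    (forall x n, Y x -> forall k : int, (exists2 j, k <= j & marker n (sh j x)) /\
                    (exists2 j, j <= k & marker n (sh j x))) &
    forall x, Y x -> exists n, ~ marker n x].
Proof.
move=> mU sepU aX0 free; have mM := marker_measurable mU.
have [Yr /all_and2[aYr hYr]] := choice (fun n => recurrence (mM n)).
have mI : measurable [set x | forall n, marker n x] by exact: measurable_forall.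
have [Z [aZ hZ]] := recurrence mI.
exists (X0 `&` (Z `&` [set x | forall n, Yr n x])); split.
- by do 2! apply: ampleI => //; exact: ample_forall.
- by move=> x [].
- move=> x n [Xx [Zx Yx]] k; have [i mi] := marker_meets n x.
  have := hYr n _ ((aYr n).2 i x (Yx n)) mi (k - i).
  move=> [[a ka ma] [b kb mb]]; rewrite -!(shD zsh) in ma mb.
  by split; [exists (a + i) | exists (b + i)] => //; lia.
- move=> x [Xx [Zx Yx]]; apply: contrapT => /forallNP nn.
  have mx n : marker n x by exact: contrapT.
  have [[j j1 mj] _] := hZ x Zx mx 1.
  have := free x j Xx (marker_cap sepU mx mj); lia.
Qed.
End Markers.
Arguments marker {d X} sh U n _.

(** * Grouping points by n inside growing finite blocks *)

Section Grouping.
Local Open Scope nat_scope.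
Context {X : eqType} (P : nat -> X -> seq X) (E : pred X) (n : nat).

(** Inside a block s, the elements of D are cut into runs of n consecutive
elements; x is grouped unless it lies in the last, incomplete run. *)
Definition section_of (D : pred X) (s : seq X) (x : X) : bool :=
  D x && (index x [seq y <- s | D y] < n * (size [seq y <- s | D y] %/ n)).

(** The points of E left over by the blocks P 0, ..., P (j - 1). *)
Fixpoint ungrouped (j : nat) : pred X :=
  if j is j'.+1 then
    fun x => ungrouped j' x && ~~ section_of (ungrouped j') (P j' x) x
  else E.

Definition grouped_at (j : nat) (x : X) : bool :=
  section_of (ungrouped j) (P j x) x.

Definition pool (j : nat) (x : X) : seq X := [seq y <- P j x | ungrouped j y].

(** n * (r %/ n) is where the run containing the element of index r begins. *)
Definition base_at (j : nat) (x : X) : X :=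
  nth x (pool j x) (n * (index x (pool j x) %/ n)).

Definition digit_at (j : nat) (x : X) : nat := index x (pool j x) %% n.

Definition group_stage (x : X) : nat := least (grouped_at ^~ x).

Definition group_base (x : X) : X := base_at (group_stage x) x.
Definition group_digit (x : X) : nat := digit_at (group_stage x) x.

Hypotheses (n_gt0 : 0 < n) (Pself : forall j x, x \in P j x)
  (Pblock : forall j x y, y \in P j x -> P j y = P j x)
  (Puniq : forall j x, uniq (P j x)).

Lemma grouped_atE j x : grouped_at j x =
  ungrouped j x && (index x (pool j x) < n * (size (pool j x) %/ n)).
Proof. by []. Qed.

Lemma ungroupedS j x : ungrouped j.+1 x = ungrouped j x && ~~ grouped_at j x.
Proof. by []. Qed.

Lemma ungrouped_le i j x : i <= j -> ungrouped j x -> ungrouped i x.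
Proof.
move=> ij; rewrite -(subnK ij); elim: (j - i) => [//|k IH].
by rewrite addSn ungroupedS => /andP[/IH].
Qed.

Lemma grouped_at_uniq i j x : grouped_at i x -> grouped_at j x -> i = j.
Proof.
have lt i' j' : i' < j' -> grouped_at i' x -> grouped_at j' x -> false.
  move=> ij gi; rewrite grouped_atE => /andP[/(ungrouped_le ij)].
  by rewrite ungroupedS gi andbF.
move=> gi gj; have [ij|ji|//] := ltngtP i j.
  by have := lt _ _ ij gi gj.
by have := lt _ _ ji gj gi.
Qed.

Lemma group_stageE j x : grouped_at j x -> group_stage x = j.
Proof.
move=> gj; apply: (grouped_at_uniq _ gj).
by apply: (@leastP (grouped_at ^~ x)); exists j.
Qed.

Lemma poolE j x y : y \in P j x -> pool j y = pool j x.
Proof. by move=> yx; rewrite /pool (Pblock yx). Qed.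

Lemma mem_pool j x : grouped_at j x -> x \in pool j x.
Proof. by move=> /andP[xj _]; rewrite mem_filter xj Pself. Qed.

Lemma pool_uniq j x : uniq (pool j x).
Proof. exact: filter_uniq. Qed.

Lemma slot_lt j x i : grouped_at j x -> i < n ->
  n * (index x (pool j x) %/ n) + i < n * (size (pool j x) %/ n).
Proof.
move=> /andP[_]; rewrite -/(pool j x) ![n * _]mulnC -ltn_divLR // => qlt ilt.
apply: (@leq_trans ((index x (pool j x) %/ n).+1 * n)); last by rewrite leq_mul2r qlt orbT.
by rewrite mulSn addnC ltn_add2r.
Qed.

Definition slot j x i := nth x (pool j x) (n * (index x (pool j x) %/ n) + i).

Lemma slot_size j x i : grouped_at j x -> i < n ->
  n * (index x (pool j x) %/ n) + i < size (pool j x).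
Proof.
move=> gx ilt; apply: leq_trans (slot_lt gx ilt) _.
by rewrite mulnC leq_trunc_div.
Qed.

Lemma slotP j x i : grouped_at j x -> i < n ->
  [/\ slot j x i \in P j x, grouped_at j (slot j x i),
      base_at j (slot j x i) = base_at j x & digit_at j (slot j x i) = i].
Proof.
move=> gx ilt; have sz := slot_size gx ilt.
have yp : slot j x i \in pool j x by exact: mem_nth.
have [yu yP] : ungrouped j (slot j x i) /\ slot j x i \in P j x.
  by move: yp; rewrite mem_filter => /andP[].
have pE := poolE yP.
have iE : index (slot j x i) (pool j (slot j x i)) =
    n * (index x (pool j x) %/ n) + i.
  by rewrite pE index_uniq// pool_uniq.
have qE : (n * (index x (pool j x) %/ n) + i) %/ n = index x (pool j x) %/ n.
  by rewrite mulnC divnMDl// (divn_small ilt) addn0.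
split=> //.
- by rewrite grouped_atE yu iE pE slot_lt.
- rewrite /base_at iE qE pE; apply: set_nth_default.
  by have := slot_size gx n_gt0; rewrite addn0.
- by rewrite /digit_at iE mulnC modnMDl modn_small.
Qed.

Lemma base_slot0 j x : base_at j x = slot j x 0.
Proof. by rewrite /slot addn0. Qed.

Lemma slot_digit j x : grouped_at j x -> slot j x (digit_at j x) = x.
Proof.
move=> gx; rewrite /slot mulnC -divn_eq nth_index//; exact: mem_pool.
Qed.

(** The base of a group is itself a member of the group, grouped at the same stage.
It therefore determines the stage and the block, whence group_inj. *)
Lemma group_baseP j x : grouped_at j x ->
  [/\ group_base x \in P j x, grouped_at j (group_base x),
      group_base (group_base x) = group_base x & group_digit (group_base x) = 0].
Proof.
move=> gx; have sE := group_stageE gx.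
rewrite /group_base sE; have [h1 h2 h3 h4] := slotP gx n_gt0.
rewrite -base_slot0 in h1 h2 h3 h4.
by split=> //; rewrite /group_digit (group_stageE h2).
Qed.

Lemma group_digit_lt x : group_digit x < n.
Proof. by rewrite /group_digit /digit_at ltn_mod. Qed.

Lemma group_member j x i : grouped_at j x -> i < n ->
  exists2 y, y \in P j x & [/\ grouped_at j y, group_base y = group_base x & group_digit y = i].
Proof.
move=> gx ilt; have [h1 h2 h3 h4] := slotP gx ilt.
exists (slot j x i) => //; split=> //.
  by rewrite /group_base (group_stageE gx) (group_stageE h2).
by rewrite /group_digit (group_stageE h2).
Qed.

Lemma group_inj i j x y : grouped_at i x -> grouped_at j y ->
  group_base x = group_base y -> group_digit x = group_digit y -> x = y.
Proof.
move=> gx gy bxy dxy.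
have [bx gbx _ _] := group_baseP gx; have [bP gby _ _] := group_baseP gy.
have ij : i = j by apply: (grouped_at_uniq gbx); rewrite bxy.
rewrite -{}ij in gy bP gby *.
have Pxy : pool i x = pool i y.
  by rewrite -(poolE bx) -(poolE bP) bxy.
rewrite -(slot_digit gx) -(slot_digit gy).
move: dxy; rewrite /group_digit (group_stageE gx) (group_stageE gy) => ->.
have dlt : digit_at i y < n by rewrite ltn_mod.
have qE : n * (index x (pool i x) %/ n) = n * (index y (pool i y) %/ n).
  move: bxy; rewrite /group_base (group_stageE gx) (group_stageE gy) /base_at.
  have sx := slot_size gx n_gt0; have sy := slot_size gy n_gt0.
  rewrite !addn0 in sx sy.
  rewrite -Pxy in sy *; rewrite (set_nth_default x y sy) => /eqP.
  by rewrite nth_uniq ?pool_uniq// => /eqP.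
have sz := slot_size gy dlt.
by rewrite /slot qE -Pxy in sz *; exact: set_nth_default.
Qed.

Lemma eventually_grouped x : E x -> (exists j, ~~ ungrouped j x) ->
  exists j, grouped_at j x.
Proof.
move=> Ex [j]; elim: j => [|j IH]; first by rewrite /= Ex.
rewrite ungroupedS negb_and negbK => /orP[/IH//|gj]; by exists j.
Qed.

(** What a block leaves over is its incomplete run.  Here s is any
set of leftover points inside one block. *)
Lemma few_ungrouped j x (s : seq X) : uniq s ->
  (forall y, y \in s -> y \in P j x /\ ungrouped j.+1 y) -> size s < n.
Proof.
move=> us sP.
have sub : {subset s <= drop (n * (size (pool j x) %/ n)) (pool j x)}.
  move=> y /sP[yP]; rewrite ungroupedS grouped_atE => /andP[yu].
  rewrite yu /= -leqNgt (poolE yP) => le.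
  have yp : y \in pool j x by rewrite mem_filter yu.
  rewrite -(nth_index y yp) -(subnKC le) -nth_drop mem_nth// size_drop.
  by rewrite ltn_sub2r// ?index_mem// (leq_ltn_trans le)// index_mem.
apply: leq_ltn_trans (uniq_leq_size us sub) _.
by rewrite size_drop mulnC {1}(divn_eq (size (pool j x)) n) addKn ltn_mod.
Qed.

Lemma same_group x y : y \in P 0 x -> E x -> E y ->
  index x (pool 0 x) %/ n = index y (pool 0 y) %/ n -> grouped_at 0 x ->
  grouped_at 0 y /\ group_base y = group_base x.
Proof.
move=> yx Ex Ey; have pE := poolE yx; rewrite pE => qE gx.
have gy : grouped_at 0 y.
  rewrite grouped_atE /= Ey /= pE.
  have := slot_lt gx (ltn_pmod (index y (pool 0 x)) n_gt0).
  by rewrite qE [n * (index y _ %/ _)]mulnC -divn_eq.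
split=> //; rewrite /group_base (group_stageE gx) (group_stageE gy) /base_at pE -qE.
by apply: set_nth_default; have := slot_size gx n_gt0; rewrite addn0.
Qed.

End Grouping.

(** * Blocks between consecutive markers *)

Section Blocks.
Context {R : realType} {d : measure_display} {X : measurableType d}.
Context {mu : probability X R} {sh : int -> X -> X} (zsh : zaction mu sh).
Context (Y : set X) (C : nat -> set X).

Record marked : Prop := {
  marked_ample : ample mu sh Y;
  marked_free : forall x i, Y x -> sh i x = x -> i = 0;
  marker_meas : forall n, measurable (C n);
  marker_decr : forall n, C n.+1 `<=` C n;
  marker_rec : forall x n, Y x -> forall k : int,
    (exists2 j, k <= j & C n (sh j x)) /\ (exists2 j, j <= k & C n (sh j x));
  marker_vanish : forall x, Y x -> exists n, ~ C n x }.

Definition behind (j : nat) (x : X) : nat :=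
  least (fun a : nat => `[< C j (sh (- a%:Z) x) >]).
Definition ahead (j : nat) (x : X) : nat :=
  least (fun a : nat => `[< C j (sh a.+1%:Z x) >]).

(** The block of x runs from the last marker at or before x to the point just
before the next one.  Off Y it is a singleton, so that blocks partition the
whole space. *)
Definition block_shifts (j : nat) (x : X) : seq int :=
  if `[< Y x >] then
    [seq a%:Z - (behind j x)%:Z | a <- iota 0 (behind j x + (ahead j x).+1)]
  else [:: 0].

Definition block (j : nat) (x : X) : seq X := [seq sh i x | i <- block_shifts j x].

Context (mk : marked).

Let iY i x : Y x -> Y (sh i x). Proof. exact: (marked_ample mk).2. Qed.

Lemma sh_free_inj x i j : Y x -> sh i x = sh j x -> i = j.
Proof.
move=> Yx ij; apply/eqP; rewrite -subr_eq0; apply/eqP; apply: (marked_free mk Yx).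
by rewrite addrC (shD zsh) ij (shK zsh).
Qed.

Lemma behindP j x : Y x -> C j (sh (- (behind j x)%:Z) x).
Proof.
move=> Yx; apply/asboolP; apply: (@leastP (fun a : nat => `[< C j (sh (- a%:Z) x) >])).
have [_ [k k0 Ck]] := marker_rec mk j Yx 0.
by exists `|k|%N; apply/asboolP; rewrite (_ : - _ = k)//; lia.
Qed.

Lemma aheadP j x : Y x -> C j (sh (ahead j x).+1%:Z x).
Proof.
move=> Yx; apply/asboolP; apply: (@leastP (fun a : nat => `[< C j (sh a.+1%:Z x) >])).
have [[k k0 Ck] _] := marker_rec mk j Yx 1.
by exists (absz k).-1%N; apply/asboolP; rewrite (_ : Posz _ = k)//; lia.
Qed.

Lemma inside_block j x (k : int) :
  - (behind j x)%:Z < k -> k <= (ahead j x)%:Z -> ~ C j (sh k x).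
Proof.
move=> k1 k2 Ck; have [k0|k0] := lerP k 0.
  have : `[< C j (sh (- `|k|%N%:Z) x) >].
    by apply/asboolP; rewrite (_ : - _ = k)//; lia.
  by move=> /(@least_min (fun a : nat => `[< C j (sh (- a%:Z) x) >])); rewrite -/(behind j x); lia.
have : `[< C j (sh (absz k).-1.+1%:Z x) >].
  by apply/asboolP; rewrite (_ : Posz _ = k)//; lia.
by move=> /(@least_min (fun a : nat => `[< C j (sh a.+1%:Z x) >])); rewrite -/(ahead j x); lia.
Qed.

Lemma mem_block_shifts j x i : Y x ->
  (i \in block_shifts j x) = (- (behind j x)%:Z <= i <= (ahead j x)%:Z).
Proof.
move=> Yx; rewrite /block_shifts asboolT//; apply/mapP/idP.
  by move=> [a]; rewrite mem_iota => ? ->; lia.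
move=> h; exists (absz (i + (behind j x)%:Z)); last lia.
by rewrite mem_iota; lia.
Qed.

Lemma behind_sh j x i : Y x -> i \in block_shifts j x ->
  (behind j (sh i x))%:Z = (behind j x)%:Z + i.
Proof.
move=> Yx; rewrite mem_block_shifts// => hi.
rewrite (_ : behind j (sh i x) = absz ((behind j x)%:Z + i)); first lia.
apply: leastE.
  apply/asboolP; rewrite -(shD zsh) (_ : _ + i = - (behind j x)%:Z); last lia.
  exact: behindP.
move=> m mlt; apply/asboolPn; rewrite -(shD zsh); apply: inside_block; lia.
Qed.

Lemma ahead_sh j x i : Y x -> i \in block_shifts j x ->
  (ahead j (sh i x))%:Z = (ahead j x)%:Z - i.
Proof.
move=> Yx; rewrite mem_block_shifts// => hi.
rewrite (_ : ahead j (sh i x) = absz ((ahead j x)%:Z - i)); first lia.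
apply: leastE.
  apply/asboolP; rewrite -(shD zsh) (_ : _ + i = (ahead j x).+1%:Z); last lia.
  exact: aheadP.
move=> m mlt; apply/asboolPn; rewrite -(shD zsh); apply: inside_block; lia.
Qed.

Lemma block_notin j x : ~ Y x -> block j x = [:: x].
Proof. by move=> nY; rewrite /block /block_shifts asboolF//= (sh0 zsh). Qed.

Lemma zero_block_shifts j x : 0 \in block_shifts j x.
Proof.
have [Yx|nYx] := pselect (Y x); first by rewrite mem_block_shifts//; lia.
by rewrite /block_shifts asboolF.
Qed.

Lemma block_self j x : x \in block j x.
Proof. by apply/mapP; exists 0; rewrite ?zero_block_shifts ?(sh0 zsh). Qed.

Lemma block_uniq j x : uniq (block j x).
Proof.
have [Yx|nYx] := pselect (Y x); last by rewrite block_notin.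
rewrite map_inj_uniq; last by move=> a b; exact: sh_free_inj.
rewrite /block_shifts asboolT// map_inj_uniq ?iota_uniq// => a b; lia.
Qed.

Lemma block_same j x y : y \in block j x -> block j y = block j x.
Proof.
have [Yx|nYx] := pselect (Y x); last by rewrite block_notin// inE => /eqP ->; rewrite block_notin.
move=> /mapP[i ip ->]; rewrite /block /block_shifts !asboolT//; last exact: iY.
rewrite -!map_comp; have bE := behind_sh Yx ip; have aE := ahead_sh Yx ip.
rewrite (_ : (_ + (ahead j (sh i x)).+1)%N = (behind j x + (ahead j x).+1)%N); last lia.
by apply: eq_map => a /=; rewrite -(shD zsh) bE; congr (sh _ x); lia.
Qed.

Lemma blockP j x y : Y x -> y \in block j x <->
  exists2 i : int, - (behind j x)%:Z <= i <= (ahead j x)%:Z & y = sh i x.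
Proof.
move=> Yx; split; first by move=> /mapP[i]; rewrite mem_block_shifts// => *; exists i.
by move=> [i ip ->]; apply: map_f; rewrite mem_block_shifts.
Qed.

Lemma sh_block j x i : Y x ->
  (sh i x \in block j x) = (- (behind j x)%:Z <= i <= (ahead j x)%:Z).
Proof.
move=> Yx; rewrite -mem_block_shifts// mem_map// => a b; exact: sh_free_inj.
Qed.

Lemma block_nest i j x : (i <= j)%N -> {subset block i x <= block j x}.
Proof.
have [Yx|nYx] := pselect (Y x); last by move=> _ y; rewrite !block_notin.
move=> ij; have Cij : C j `<=` C i.
  rewrite -(subnK ij); elim: (j - i)%N => [//|k IH].
  by apply: subset_trans IH; rewrite addSn; exact: marker_decr.
have bl : (behind i x <= behind j x)%N.
  by apply: least_min; apply/asboolP/Cij; exact: behindP.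
have al : (ahead i x <= ahead j x)%N.
  by apply: least_min; apply/asboolP/Cij; exact: aheadP.
move=> y /(blockP i _ Yx)[k kb ->]; apply/(blockP j _ Yx); exists k => //; lia.
Qed.

Lemma next_in_block j x : Y x -> ~ C j (sh 1 x) -> sh 1 x \in block j x.
Proof.
move=> Yx nC; rewrite sh_block//.
suff : ahead j x <> 0%N by lia.
by move=> a0; apply: nC; have := aheadP j Yx; rewrite a0.
Qed.

(** This is where vanishing is used: T x leaves the block of x only if T x is itself
a marker. *)
Lemma next_eventually x : Y x -> exists J, forall j, (J <= j)%N -> sh 1 x \in block j x.
Proof.
move=> Yx; have [J nC] := marker_vanish mk (iY 1 Yx).
exists J => j Jj; apply: (block_nest Jj); exact: next_in_block.
Qed.

Lemma block_exhaust x : Y x -> forall n : nat, exists J, forall j, (J <= j)%N ->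
  sh n%:Z x \in block j x.
Proof.
move=> Yx; elim=> [|n [J IH]]; first by exists 0%N => j _; rewrite (sh0 zsh) block_self.
have [J' hJ'] := next_eventually (iY n%:Z Yx).
exists (maxn J J') => j; rewrite geq_max => /andP[Jj J'j].
rewrite -(block_same (IH j Jj)) (_ : n.+1%:Z = 1 + n%:Z); last lia.
by rewrite (shD zsh); exact: hJ'.
Qed.

Lemma dm_behind j : dm (behind j).
Proof.
apply: dm_least => n; apply: dm_asbool.
exact: (sh_measurable zsh _ (marker_meas mk j)).
Qed.

Lemma dm_ahead j : dm (ahead j).
Proof.
apply: dm_least => n; apply: dm_asbool.
exact: (sh_measurable zsh _ (marker_meas mk j)).
Qed.

Lemma dm_block_shifts j : dm (block_shifts j).
Proof.
pose f (b : bool) (p : nat * nat) : seq int :=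
  if b then [seq a%:Z - p.1%:Z | a <- iota 0 (p.1 + p.2.+1)] else [:: 0].
apply: (dm_comp2 f (dm_asbool (marked_ample mk).1.1)
  (dm_comp2 pair (dm_behind j) (dm_ahead j))).
Qed.

Section Counting.
Context (E : pred X).

(** rank counts the points of E strictly before x in its block, tail_count those
from x on; the two add up to the size of the pool. *)
Definition rank (j : nat) (x : X) : nat :=
  count E [seq sh (a%:Z - (behind j x)%:Z) x | a <- iota 0 (behind j x)].
Definition tail_count (j : nat) (x : X) : nat :=
  count E [seq sh a%:Z x | a <- iota 0 (ahead j x).+1].

Lemma block_split j x : Y x -> block j x =
  [seq sh (a%:Z - (behind j x)%:Z) x | a <- iota 0 (behind j x)] ++
  [seq sh a%:Z x | a <- iota 0 (ahead j x).+1].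
Proof.
move=> Yx; rewrite /block /block_shifts asboolT// -map_comp iotaD map_cat; congr (_ ++ _).
rewrite add0n -[in LHS](addn0 (behind j x)) iotaDl -map_comp.
by apply: eq_map => a /=; congr (sh _ x); lia.
Qed.

Lemma size_filter_block j x : Y x ->
  size [seq y <- block j x | E y] = (rank j x + tail_count j x)%N.
Proof. by move=> Yx; rewrite size_filter block_split// count_cat. Qed.

Lemma index_filter_block j x : Y x -> E x ->
  index x [seq y <- block j x | E y] = rank j x.
Proof.
move=> Yx Ex; have := block_uniq j x; rewrite block_split//= cat_uniq => /and3P[_ /hasPn nh _].
rewrite filter_cat index_cat /= (sh0 zsh) Ex /= eqxx addn0 size_filter.
rewrite ifF//; apply/negbTE; rewrite mem_filter Ex /=; apply: nh.
by rewrite (sh0 zsh) mem_head.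
Qed.

Lemma rank_next j x : Y x -> sh 1 x \in block j x ->
  rank j (sh 1 x) = (rank j x + E x)%N.
Proof.
move=> Yx xb; have ip : 1 \in block_shifts j x.
  by rewrite mem_block_shifts// -sh_block.
have bE : behind j (sh 1 x) = (behind j x).+1 by have := behind_sh Yx ip; lia.
rewrite /rank bE -addn1 iotaD map_cat count_cat /= addn0 add0n; congr (_ + _)%N.
  by congr count; apply: eq_map => a; rewrite -(shD zsh); congr (sh _ x); lia.
by rewrite -(shD zsh) (_ : _ + 1 = 0) ?(sh0 zsh)//; lia.
Qed.

Lemma tail_count_eventually x n : Y x ->
  (forall k : int, exists2 j, k <= j & E (sh j x)) ->
  exists J, forall j, (J <= j)%N -> (n <= tail_count j x)%N.
Proof.
move=> Yx Erec.
have [L hL] : exists L, (n <= count E [seq sh a%:Z x | a <- iota 0 L])%N.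
  elim: n => [|n [L IH]]; first by exists 0%N.
  have [i Li Ei] := Erec L%:Z; exists (absz i).+1.
  have -> : (absz i).+1 = (L + ((absz i - L) + 1))%N by lia.
  rewrite !iotaD !map_cat !count_cat /= add0n.
  rewrite (_ : (Posz _) = i); last lia.
  by rewrite Ei; lia.
have [J hJ] := block_exhaust Yx L; exists J => j /hJ; rewrite sh_block// => Lb.
apply: leq_trans hL _; rewrite /tail_count.
have -> : (ahead j x).+1 = (L + ((ahead j x).+1 - L))%N by lia.
by rewrite iotaD map_cat count_cat leq_addr.
Qed.

End Counting.

End Blocks.
Arguments marked {R d X} mu sh Y C.
Arguments behind {d X} sh C j x.
Arguments ahead {d X} sh C j x.
Arguments block_shifts {d X} sh Y C j x.
Arguments block {d X} sh Y C j x.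
Arguments rank {d X} sh C E j x.
Arguments tail_count {d X} sh C E j x.

(** * Uniform subrelations of the orbit relation *)

Section Stages.
Context {R : realType} {d : measure_display} {X : measurableType d}.
Context {mu : probability X R} {sh : int -> X -> X} (zsh : zaction mu sh).
Context {Y : set X} {C : nat -> set X} (mk : marked mu sh Y C).

(** A stage encodes an equivalence relation inside the orbits: two points are
equivalent when they have the same root, a chosen element of their class, and
label enumerates each class from 0, the label of the root.  The root is given
by its position relative to x. *)
Record stage : Type := Stage {
  num_labels : nat; root_shift : X -> int; label : X -> nat; carrier : set X }.

Definition stage_root (s : stage) (x : X) : X := sh (root_shift s x) x.

Record stage_ok (s : stage) : Prop := {
  num_labels_gt0 : (0 < num_labels s)%N;
  root_dm : dm (root_shift s);
  label_dm : dm (label s);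
  carrier_ample : ample mu sh (carrier s);
  carrier_sub : carrier s `<=` Y;
  label_lt : forall x, carrier s x -> (label s x < num_labels s)%N;
  label_root : forall x, carrier s x -> label s (stage_root s x) = 0%N;
  root_root : forall x, carrier s x -> stage_root s (stage_root s x) = stage_root s x;
  label_onto : forall x i, carrier s x -> (i < num_labels s)%N ->
    exists k, stage_root s (sh k x) = stage_root s x /\ label s (sh k x) = i;
  label_inj : forall x y, carrier s x -> carrier s y ->
    stage_root s x = stage_root s y -> label s x = label s y -> x = y }.

Lemma carrier_sh s i x : stage_ok s -> carrier s x -> carrier s (sh i x).
Proof. by move=> ok; exact: (carrier_ample ok).2. Qed.

(** Equality of the roots of x and sh k x, read off from the codes. *)
Definition same_root (s : stage) (k : int) (x : X) : bool :=
  root_shift s (sh k x) + k == root_shift s x.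

Lemma same_rootP s k x : stage_ok s -> carrier s x ->
  reflect (stage_root s (sh k x) = stage_root s x) (same_root s k x).
Proof.
move=> ok cx; apply: (iffP eqP); rewrite /stage_root -(shD zsh); first by move=> ->.
by apply: (sh_free_inj zsh mk); exact: (carrier_sub ok).
Qed.

Lemma dm_same_root s k : stage_ok s -> dm (same_root s k).
Proof.
move=> ok; have h := dm_sh zsh k (root_dm ok).
exact: (dm_comp2 (fun a b => a + k == b) h (root_dm ok)).
Qed.

Lemma root_fixed s x : stage_ok s -> carrier s x -> label s x = 0%N -> stage_root s x = x.
Proof.
move=> ok cx l0; apply: (label_inj ok) => //.
- exact: carrier_sh.
- exact: root_root.
- by rewrite label_root.
Qed.

Definition slice (s : stage) (i : nat) : set X :=
  [set x | carrier s x /\ label s x = i].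

Lemma slice_measurable s i : stage_ok s -> measurable (slice s i).
Proof.
move=> ok; apply: measurableI; first exact: (carrier_ample ok).1.1.
exact: (label_dm ok [set i]).
Qed.

(** The shift that leads from x to the point of its class with label f x. *)
Definition to_label (s : stage) (f : X -> nat) : X -> int :=
  find_code 0 (fun k x => same_root s k x && (label s (sh k x) == f x)).

Lemma to_labelP s f x : stage_ok s -> carrier s x -> (f x < num_labels s)%N ->
  stage_root s (sh (to_label s f x) x) = stage_root s x /\ label s (sh (to_label s f x) x) = f x.
Proof.
move=> ok cx fx; rewrite /to_label.
have [|h1 /eqP h2] := andP (@find_codeP _ _ _ 0 (fun k x =>
    same_root s k x && (label s (sh k x) == f x)) x _); last first.
  by split=> //; apply/same_rootP.
have [k [rk lk]] := label_onto ok cx fx; exists k.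
by rewrite lk eqxx andbT; apply/same_rootP.
Qed.

Lemma dm_to_label s f : stage_ok s -> dm f -> dm (to_label s f).
Proof.
move=> ok mf; apply: dm_find_code => k.
apply: (dm_comp2 andb (dm_same_root k ok)).
exact: (dm_comp2 (fun a b => a == b) (dm_sh zsh k (label_dm ok)) mf).
Qed.

(** Moving inside the classes transports each slice onto every other slice, so the
disjoint slices all have the same mass. *)
Lemma slice_mass s i : stage_ok s -> (i < num_labels s)%N ->
  (num_labels s)%:R * mass mu (slice s i) <= 1.
Proof.
move=> ok ilt; apply: (@mass_disjoint _ _ _ mu (slice s)).
- by move=> l; exact: slice_measurable.
- by move=> a b x _ _ [_ <-] [_ <-].
move=> l llt; have ml : dm (to_label s (fun=> l)) by apply: dm_to_label => //; exact: dm_cst.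
apply: (mass_transport zsh (slice_measurable i ok) (slice_measurable l ok) ml).
- move=> x [cx lx]; have [r2 l2] := to_labelP (f := fun=> l) ok cx llt.
  by split=> //; exact: carrier_sh.
- move=> x y [cx lx] [cy ly] E; apply: (label_inj ok) => //; last by rewrite lx ly.
  have [rx _] := to_labelP (f := fun=> l) ok cx llt.
  have [ry _] := to_labelP (f := fun=> l) ok cy llt.
  by rewrite -rx -ry E.
Qed.

(** Each class of s' consists of n classes of s, numbered by g.  The shape of the
labels of s' makes g the least significant digit: advancing a label of s' by n
then advances the label of s by one, which is what turns the rotation of s into
the n-th power of the rotation of s'. *)
Record refines (s s' : stage) (n : nat) : Prop := {
  refines_order : num_labels s' = (n * num_labels s)%N;
  refines_carrier : carrier s' `<=` carrier s;
  refines_label : exists g : X -> nat,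
    [/\ forall x, carrier s' x -> (g x < n)%N,
        forall x, carrier s' x -> label s' x = (n * label s x + g x)%N &
        forall x y, carrier s' x -> carrier s' y ->
          stage_root s x = stage_root s y <-> stage_root s' x = stage_root s' y /\ g x = g y] }.

End Stages.
Arguments stage {d} X.
Arguments stage_root {d X} sh s x.
Arguments stage_ok {R d X} mu sh Y s.
Arguments refines {d X} sh s s' n.
Arguments same_root {d X} sh s k x.
Arguments to_label {d X} sh s f x.

(** * Refining a stage *)

Section Step.
Context {R : realType} {d : measure_display} {X : measurableType d}.
Context {mu : probability X R} {sh : int -> X -> X} (zsh : zaction mu sh).
Context {Y : set X} {C : nat -> set X} (mk : marked mu sh Y C).
Context {s : stage X} (ok : stage_ok mu sh Y s).
Context (n j0 : nat).

Definition is_root : pred X := fun x => `[< carrier s x >] && (label s x == 0%N).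

Local Notation P := (fun j => block sh Y C (j0 + j)).
Local Notation D := (ungrouped P is_root n).

(** The grouping of the roots of s inside the blocks P j, which start with the
marker j0, is redone here with shifts in place of points, to see that it is
measurable. *)
Definition pool_shifts (j : nat) (x : X) : seq int :=
  [seq i <- block_shifts sh Y C (j0 + j) x | D j (sh i x)].

Lemma pool_shiftsE j x : pool P is_root n j x = [seq sh i x | i <- pool_shifts j x].
Proof. by rewrite /pool /block filter_map. Qed.

Lemma index_pool j x : index x (pool P is_root n j x) = index 0%R (pool_shifts j x).
Proof.
rewrite pool_shiftsE; have [Yx|nYx] := pselect (Y x).
  rewrite -[X in index X _](sh0 zsh) index_map// => a b.
  exact: (sh_free_inj zsh mk Yx).
rewrite /pool_shifts /block_shifts asboolF//= (sh0 zsh).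
by case: ifP => //= _; rewrite (sh0 zsh) !eqxx.
Qed.

Lemma dm_roots : dm is_root.
Proof.
apply: (dm_comp2 (fun a b => a && (b == 0%N)) _ (label_dm ok)).
by apply: dm_asbool; exact: (carrier_ample ok).1.1.
Qed.

Lemma dm_pool_shifts_of j : dm (D j) -> dm (pool_shifts j).
Proof.
move=> mD; apply: (dm_bind (F := fun b x => [seq i <- b | D j (sh i x)])).
  exact: (dm_block_shifts zsh mk).
by move=> b; apply: dm_filter => i; exact: (dm_sh zsh).
Qed.

Lemma grouped_code j x : grouped_at P is_root n j x =
  D j x && (index 0%R (pool_shifts j x) < n * (size (pool_shifts j x) %/ n))%N.
Proof.
by rewrite grouped_atE index_pool pool_shiftsE size_map.
Qed.

Lemma dm_grouped_of j : dm (D j) -> dm (grouped_at P is_root n j).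
Proof.
move=> mD; rewrite (_ : grouped_at _ _ _ _ = fun x =>
  D j x && (index 0%R (pool_shifts j x) < n * (size (pool_shifts j x) %/ n))%N).
  apply: (dm_comp2 (fun b (l : seq int) => b && (index 0%R l < n * (size l %/ n))%N) mD).
  exact: dm_pool_shifts_of.
by apply/funext => x; exact: grouped_code.
Qed.

Lemma dm_ungrouped j : dm (D j).
Proof.
elim: j => [|j IH]; first exact: dm_roots.
exact: (dm_comp2 (fun a b => a && ~~ b) IH (dm_grouped_of IH)).
Qed.

Lemma dm_grouped j : dm (grouped_at P is_root n j).
Proof. exact/dm_grouped_of/dm_ungrouped. Qed.

Lemma dm_pool_shifts j : dm (pool_shifts j).
Proof. exact/dm_pool_shifts_of/dm_ungrouped. Qed.

Lemma dm_group_stage : dm (group_stage P is_root n).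
Proof. by apply: dm_least => j; exact: dm_grouped. Qed.

Definition base_shift_at (j : nat) (x : X) : int :=
  nth 0 (pool_shifts j x) (n * (index 0%R (pool_shifts j x) %/ n)).

Definition base_shift (x : X) : int := base_shift_at (group_stage P is_root n x) x.

Lemma base_shiftE x : group_base P is_root n x = sh (base_shift x) x.
Proof.
rewrite /group_base /base_shift /base_at /base_shift_at index_pool pool_shiftsE.
set k := (n * _)%N; set l := pool_shifts _ x.
have [kl|lk] := ltnP k (size l); first by rewrite (nth_map 0).
by rewrite !nth_default ?size_map// (sh0 zsh).
Qed.

Lemma dm_base_shift : dm base_shift.
Proof.
apply: (dm_bind (F := base_shift_at) dm_group_stage) => j.
exact: (dm_comp (fun l => nth 0%R l (n * (index 0%R l %/ n))) (dm_pool_shifts j)).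
Qed.

Lemma dm_group_digit : dm (group_digit P is_root n).
Proof.
apply: (dm_bind (F := digit_at P is_root n) dm_group_stage) => j.
rewrite (_ : digit_at _ _ _ _ = fun x => (index 0%R (pool_shifts j x) %% n)%N).
  exact: (dm_comp (fun l => (index 0%R l %% n)%N) (dm_pool_shifts j)).
by apply/funext => x; rewrite /digit_at index_pool.
Qed.

Definition next_stage (Y1 : set X) : stage X := Stage
  (n * num_labels s)
  (fun x => base_shift (sh (root_shift s x) x) + root_shift s x)
  (fun x => (n * label s x + group_digit P is_root n (stage_root sh s x))%N)
  (carrier s `&` Y1).

Lemma next_root Y1 x : stage_root sh (next_stage Y1) x =
  group_base P is_root n (stage_root sh s x).
Proof. by rewrite base_shiftE /stage_root /= (shD zsh). Qed.

Hypothesis n_gt0 : (0 < n)%N.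

Let Pself j x : x \in P j x. Proof. exact: (block_self zsh). Qed.
Let Pblock j x y : y \in P j x -> P j y = P j x. Proof. exact: (block_same zsh mk). Qed.
Let Puniq j x : uniq (P j x). Proof. exact: (block_uniq zsh mk). Qed.

(** n points of an orbit lie together in all blocks from some stage on, so an orbit
has fewer than n points that are never grouped; by recurrence almost every
orbit has none. *)
Lemma all_grouped : exists Y1, ample mu sh Y1 /\
  forall x, carrier s x -> Y1 x -> is_root x -> exists j, grouped_at P is_root n j x.
Proof.
pose Z : set X := [set x | Y x /\ forall j, D j x].
have mZ : measurable Z.
  apply: measurableI; first exact: (marked_ample mk).1.1.
  by apply: measurable_forall => j; apply: dm_measurable; exact: dm_ungrouped.
have [Y1 [aY1 hY1]] := forward_recurrence zsh mZ.
exists Y1; split=> // x cx Y1x rx.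
apply: (eventually_grouped rx); apply: contrapT => /forallNP nu.
have Yx := carrier_sub ok cx.
have Zx : Z x by split=> // j; have /negP := nu j; rewrite negbK.
pose Zb : pred X := fun y => `[< Z y >].
have Zrec (k : int) : exists2 j : int, k <= j & Zb (sh j x).
  by have [j kj Zj] := hY1 x Y1x Zx k; exists j => //; apply/asboolP.
have [J hJ] := tail_count_eventually zsh mk (E := Zb) n Yx Zrec.
pose l := [seq y <- block sh Y C (j0 + J) x | Zb y].
have : (size l < n)%N.
  apply: (@few_ungrouped _ P is_root n n_gt0 Pblock J x) => //.
  - by apply: filter_uniq; exact: Puniq.
  - move=> y; rewrite mem_filter => /andP[/asboolP Zy yb]; split=> //.
    by case: Zy => _; exact.
rewrite ltnNge => /negP; apply.
rewrite size_filter_block//.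
by apply: leq_trans (hJ _ (leq_addl _ _)) _; exact: leq_addl.
Qed.

Lemma root_roots x : carrier s x -> is_root (stage_root sh s x).
Proof.
move=> cx; rewrite /is_root (label_root ok cx) eqxx andbT; apply/asboolP.
exact: (carrier_sh _ ok).
Qed.

Lemma rootsP x : is_root x -> carrier s x /\ stage_root sh s x = x.
Proof.
by move=> /andP[/asboolP cx /eqP lx]; split=> //; exact: (root_fixed ok).
Qed.

Lemma grouped_roots j x : grouped_at P is_root n j x -> is_root x.
Proof. by move=> /andP[/(ungrouped_le (leq0n j))]. Qed.

Section WithY1.
Context {Y1 : set X} (aY1 : ample mu sh Y1).
Hypothesis grouped1 : forall x, carrier s x -> Y1 x -> is_root x ->
  exists j, grouped_at P is_root n j x.

Local Notation s' := (next_stage Y1).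
Local Notation rt := (stage_root sh s).

Lemma root_grouped x : carrier s' x -> exists j, grouped_at P is_root n j (rt x).
Proof.
move=> [cx Yx]; apply: grouped1; [exact: (carrier_sh _ ok)|exact: aY1.2|exact: root_roots].
Qed.

Lemma block_orbit j x y : Y x -> y \in block sh Y C j x -> exists i, y = sh i x.
Proof. by move=> Yx /(blockP _ _ _ Yx)[i _ ->]; exists i. Qed.

Lemma next_stage_ok : stage_ok mu sh Y s'.
Proof.
have aS' : ample mu sh (carrier s `&` Y1) by apply: ampleI => //; exact: (carrier_ample ok).
split=> //.
- by rewrite muln_gt0 n_gt0 (num_labels_gt0 ok).
- have mb := dm_sh_bind zsh dm_base_shift (root_dm ok).
  exact: (dm_comp2 (fun a b => a + b) mb (root_dm ok)).
- have mdg := dm_sh_bind zsh dm_group_digit (root_dm ok).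
  exact: (dm_comp2 (fun a b => (n * a + b)%N) (label_dm ok) mdg).
- by move=> x [/(carrier_sub ok)].
- move=> x [cx Y1x] /=; have gl := group_digit_lt P is_root n_gt0 (rt x).
  have ll := label_lt ok cx; move: gl; rewrite -[X in (_ < X)%N -> _]muln1 => gl.
  apply: (@leq_trans (n * label s x + n)%N); first by rewrite ltn_add2l; lia.
  by rewrite -mulnSr leq_mul2l ll orbT.
- move=> x cx; have [j gj] := root_grouped cx.
  have [bP gb bb b0] := group_baseP n_gt0 Pblock Puniq gj.
  have [cb rb] := rootsP (grouped_roots gb).
  rewrite next_root /= rb b0 addn0.
  by have /andP[_ /eqP ->] := grouped_roots gb; rewrite muln0.
- move=> x cx; have [j gj] := root_grouped cx.
  have [bP gb bb b0] := group_baseP n_gt0 Pblock Puniq gj.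
  have [cb rb] := rootsP (grouped_roots gb).
  by rewrite !next_root rb bb.
- move=> x i cx ilt; have [j gj] := root_grouped cx.
  have di : (i %% n < n)%N by rewrite ltn_mod.
  have [y yP [gy by_ dy]] := group_member n_gt0 Pblock Puniq gj di.
  have [cy ry] := rootsP (grouped_roots gy).
  have qi : (i %/ n < num_labels s)%N by rewrite ltn_divLR// mulnC.
  have [k [rk lk]] := label_onto ok cy qi.
  have [a ya] := block_orbit (carrier_sub ok (carrier_sh (root_shift s x) ok cx.1)) yP.
  exists (k + (a + root_shift s x)).
  have xE : sh (k + (a + root_shift s x)) x = sh k y by rewrite ya !(shD zsh).
  rewrite !next_root xE rk ry by_; split=> //=.
  by rewrite rk ry lk dy mulnC -divn_eq.
- move=> x y cx cy; rewrite !next_root /= => bE lE.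
  have [j gj] := root_grouped cx; have [j' gj'] := root_grouped cy.
  have gx := group_digit_lt P is_root n_gt0 (rt x).
  have gy := group_digit_lt P is_root n_gt0 (rt y).
  have dE : group_digit P is_root n (rt x) = group_digit P is_root n (rt y).
    have := congr1 (modn^~ n) lE; rewrite /= ![(n * _)%N]mulnC !modnMDl.
    by rewrite !modn_small.
  have rE : rt x = rt y by apply: (group_inj n_gt0 Pself Pblock Puniq gj gj').
  apply: (label_inj ok cx.1 cy.1 rE); apply/eqP.
  by move: lE; rewrite dE => /addIn/eqP; rewrite eqn_mul2l => /orP[/eqP n0|//]; lia.
Qed.

Lemma next_stage_refines : refines sh s s' n.
Proof.
split=> //; first by move=> x [].
exists (fun x => group_digit P is_root n (rt x)); split=> //.
  by move=> x _; exact: group_digit_lt.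
move=> x y cx cy; rewrite !next_root; split=> [->//|[bE dE]].
have [j gj] := root_grouped cx; have [j' gj'] := root_grouped cy.
exact: (group_inj n_gt0 Pself Pblock Puniq gj gj').
Qed.

(** Between two points with no obstacle in between, nothing separates the groups
of their roots: no block ends (gap), no group is completed (last_in_group), and
the group containing the earlier point is not the incomplete last run of the
block (short_tail). *)
Definition gap : set X := [set y | Y y /\ C j0 (sh 1 y)].
Definition last_in_group : set X :=
  [set y | is_root y /\ group_digit P is_root n y = n.-1].
Definition short_tail : set X :=
  [set y | Y y /\ (tail_count sh C is_root j0 y < n)%N].
Definition obstacle : set X := gap `|` last_in_group `|` short_tail.

(** rank %/ n is the number of the current run.  It changes only after a root whose
rank is n - 1 modulo n; then its run is complete, so that this root is grouped,
with digit n - 1. *)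
Lemma group_step y : Y y -> ~ obstacle y ->
  sh 1 y \in block sh Y C j0 y /\
  (rank sh C is_root j0 (sh 1 y) %/ n = rank sh C is_root j0 y %/ n)%N.
Proof.
move=> Yy nO.
have ng : ~ C j0 (sh 1 y) by move=> h; apply: nO; left; left.
have yb := next_in_block zsh mk Yy ng; split=> //.
rewrite (rank_next zsh mk _ Yy yb).
case ry: (is_root y) => /=; last by rewrite addn0.
set r := rank _ _ _ _ _.
suff nr : (r %% n)%N <> n.-1.
  have rlt : ((r %% n).+1 < n)%N by have := ltn_pmod r n_gt0; lia.
  by rewrite addn1 [in LHS](divn_eq r n) -addnS divnMDl// (divn_small rlt) addn0.
move=> rn; apply: nO; left; right; split=> //.
have iE : index y (pool P is_root n 0 y) = r.
  by rewrite /pool /= addn0; exact: (index_filter_block zsh mk).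
have sz : (r < size (pool P is_root n 0 y))%N.
  by rewrite -iE index_mem mem_filter /= ry Pself.
have gy : grouped_at P is_root n 0 y.
  rewrite grouped_atE /= ry /= iE mulnC -ltn_divLR//.
  rewrite ltn_divLR// mulnC.
  have : (n * (r %/ n).+1 <= n * (size (pool P is_root n 0 y) %/ n))%N.
    rewrite leq_mul2l leq_divRL// mulSn addnC; apply/orP; right.
    by move: sz; rewrite {1}(divn_eq r n) rn; lia.
  by apply: leq_trans; rewrite mulnS addnC [X in (X < _)%N](divn_eq r n) mulnC rn ltn_add2l; lia.
by rewrite /group_digit (group_stageE gy) /digit_at iE.
Qed.

Lemma group_chain y (m : nat) : Y y ->
  (forall i, (i < m)%N -> ~ obstacle (sh i%:Z y)) ->
  sh m%:Z y \in block sh Y C j0 y /\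
  (rank sh C is_root j0 (sh m%:Z y) %/ n = rank sh C is_root j0 y %/ n)%N.
Proof.
move=> Yy; elim: m => [|m IH] nO; first by rewrite (sh0 zsh) (block_self zsh).
have [bm rm] : _ /\ _ := IH (fun i im => nO i (ltnW im)).
have Ym : Y (sh m%:Z y) by exact: (marked_ample mk).2.
have [b1 r1] := group_step Ym (nO m (ltnSn m)).
have -> : sh m.+1%:Z y = sh 1 (sh m%:Z y) by rewrite -(shD zsh); congr (sh _ y); lia.
by rewrite r1 rm -(block_same zsh mk bm).
Qed.

Lemma group_base_chain y (m : nat) : is_root y -> is_root (sh m%:Z y) ->
  (forall i, (i <= m)%N -> ~ obstacle (sh i%:Z y)) ->
  group_base P is_root n (sh m%:Z y) = group_base P is_root n y.
Proof.
move=> ry rm nO; have [cy _] := rootsP ry; have Yy := carrier_sub ok cy.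
have [bm rkm] := group_chain Yy (fun i im => nO i (ltnW im)).
have Ym : Y (sh m%:Z y) by exact: (marked_ample mk).2.
have iE z : Y z -> is_root z -> index z (pool P is_root n 0 z) = rank sh C is_root j0 z.
  by move=> Yz rz; rewrite /pool /= addn0; exact: (index_filter_block zsh mk).
have nt : ~ short_tail y.
  by have := nO 0%N isT; rewrite (sh0 zsh) => h ?; apply: h; right.
have tl : (n <= tail_count sh C is_root j0 y)%N.
  by rewrite leqNgt; apply/negP => h; apply: nt.
have gy : grouped_at P is_root n 0 y.
  rewrite grouped_atE /= ry /= iE// /pool /= addn0 size_filter_block//.
  set r := rank _ _ _ _ _.
  have : (n * (r %/ n).+1 <= n * ((r + tail_count sh C is_root j0 y) %/ n))%N.
    rewrite leq_mul2l leq_divRL// mulSn addnC; apply/orP; right.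
    by have := leq_trunc_div r n; lia.
  by apply: leq_trans; rewrite mulnS addnC [X in (X < _)%N](divn_eq r n) mulnC ltn_add2l ltn_mod.
have bm0 : sh m%:Z y \in block sh Y C (j0 + 0) y by rewrite addn0.
have rE : (index y (pool P is_root n 0 y) %/ n = index (sh m%:Z y) (pool P is_root n 0 (sh m%:Z y)) %/ n)%N.
  by rewrite !iE.
by have [] := @same_group _ P is_root n n_gt0 Pblock y (sh m%:Z y) bm0 ry rm rE gy.
Qed.

End WithY1.
End Step.
Arguments is_root {d X} s x.
Arguments next_stage {d X} sh Y C s n j0 Y1.
Arguments gap {d X} sh Y C j0 _.
Arguments last_in_group {d X} sh Y C s n j0 _.
Arguments short_tail {d X} sh Y C s n j0 _.
Arguments obstacle {d X} sh Y C s n j0 _.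

(** * Capturing most of the generator *)

Section Estimate.
Context {R : realType} {d : measure_display} {X : measurableType d}.
Context {mu : probability X R} {sh : int -> X -> X} (zsh : zaction mu sh).
Context {Y : set X} {C : nat -> set X} (mk : marked mu sh Y C).
Context {s : stage X} (ok : stage_ok mu sh Y s).

Local Notation mass := (mass mu).

Lemma dm_tail_count (E : pred X) j : dm E -> dm (tail_count sh C E j).
Proof.
move=> mE; rewrite (_ : tail_count sh C E j = fun x =>
    size [seq a <- iota 0 (ahead sh C j x).+1 | E (sh a%:Z x)]).
  apply: dm_comp.
  apply: (dm_bind (F := fun l x => [seq a <- iota 0 l.+1 | E (sh a%:Z x)])
    (dm_ahead zsh mk j)) => l.
  by apply: dm_filter => a; exact: (dm_sh zsh).
by apply/funext => x; rewrite /tail_count count_map size_filter.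
Qed.

Lemma gap_measurable j : measurable (gap sh Y C j).
Proof.
apply: measurableI; first exact: (marked_ample mk).1.1.
exact: (sh_measurable zsh _ (marker_meas mk j)).
Qed.

Lemma last_measurable n j : measurable (last_in_group sh Y C s n j).
Proof.
apply: measurableI; first exact/dm_measurable/(dm_roots ok).
exact: (dm_group_digit zsh mk ok n j [set n.-1]).
Qed.

Lemma short_measurable n j : measurable (short_tail sh Y C s n j).
Proof.
apply: measurableI; first exact: (marked_ample mk).1.1.
exact: (dm_tail_count j (dm_roots ok) [set k | (k < n)%N]).
Qed.

Lemma obstacle_measurable n j : measurable (obstacle sh Y C s n j).
Proof.
apply: measurableU; last exact: short_measurable.
by apply: measurableU; [exact: gap_measurable|exact: last_measurable].
Qed.

Definition window (M : nat) : seq int := [seq a%:Z - M%:Z | a <- iota 0 (M.*2.+2)].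

Lemma mem_window M (i : int) : (i \in window M) = (- M%:Z <= i <= M.+1%:Z).
Proof.
apply/mapP/idP; first by move=> [a]; rewrite mem_iota => ? ->; lia.
move=> h; exists (absz (i + M%:Z)); last lia.
by rewrite mem_iota; lia.
Qed.

Definition far (M : nat) : set X :=
  [set x | (M < `|root_shift s x|)%N || (M < `|root_shift s (sh 1 x)|)%N].

(** The two roots and the interval between them lie in the window around x; the
window reaches one further on the right because the second root belongs to
T x. *)
Lemma same_group_near n j Y1 M x : (0 < n)%N -> carrier s x -> ~ far M x ->
  (forall i, i \in window M -> ~ obstacle sh Y C s n j (sh i x)) ->
  stage_root sh (next_stage sh Y C s n j Y1) (sh 1 x) =
  stage_root sh (next_stage sh Y C s n j Y1) x.
Proof.
move=> n0 cx /negP; rewrite negb_or -!leqNgt => /andP[aM bM] nO.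
rewrite !(next_root zsh mk) /stage_root -(shD zsh).
set a := root_shift s x in aM *; set b := root_shift s _ + 1.
have ra : is_root s (sh a x) by exact: (root_roots ok cx).
have rb : is_root s (sh b x).
  rewrite /b (shD zsh); exact: (root_roots ok (carrier_sh 1 ok cx)).
have hb : (- M%:Z <= b <= M.+1%:Z) by rewrite /b; lia.
have [ab|/ltW ba] := lerP a b.
- have bE : sh b x = sh `|b - a|%N%:Z (sh a x) by rewrite -(shD zsh); congr (sh _ x); lia.
  rewrite bE; apply: (group_base_chain zsh mk ok n0 ra); first by rewrite -bE.
  move=> i ilt; rewrite -(shD zsh); apply: nO; rewrite mem_window; lia.
- have aE : sh a x = sh `|a - b|%N%:Z (sh b x) by rewrite -(shD zsh); congr (sh _ x); lia.
  rewrite aE; apply/esym; apply: (group_base_chain zsh mk ok n0 rb); first by rewrite -aE.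
  move=> i ilt; rewrite -(shD zsh); apply: nO; rewrite mem_window; lia.
Qed.

Lemma far_measurable M : measurable (far M).
Proof.
have mr := root_dm ok; have mr1 := dm_sh zsh 1 mr.
apply: dm_measurable.
exact: (dm_comp2 (fun a b => (M < `|a|)%N || (M < `|b|)%N) mr mr1).
Qed.

Lemma far_small eps : 0 < eps -> exists M, mass (far M) < eps.
Proof.
move=> e0; have cY : conull mu setT by split; rewrite ?setCT.
have [|J hJ] := eventually_small cY far_measurable _ e0; last by exists J; exact: hJ.
move=> x _; exists (maxn `|root_shift s x| `|root_shift s (sh 1 x)|)%N => j.
by rewrite geq_max => /andP[h1 h2] /orP[]; rewrite ltnNge ?h1 ?h2.
Qed.

Lemma gap_small eps : 0 < eps ->
  exists J, forall j, (J <= j)%N -> mass (gap sh Y C j) < eps.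
Proof.
apply: (eventually_small (marked_ample mk).1 gap_measurable) => x Yx.
have [J nC] := marker_vanish mk ((marked_ample mk).2 1 x Yx).
exists J => j Jj [_ Cj]; apply: nC.
rewrite -(subnK Jj) in Cj; elim: (j - J)%N Cj => [//|k IH].
by rewrite addSn => /(marker_decr mk).
Qed.

Lemma short_small n eps : 0 < eps ->
  exists J, forall j, (J <= j)%N -> mass (short_tail sh Y C s n j) < eps.
Proof.
have mr := dm_measurable (dm_roots ok).
have [Z [aZ hZ]] := forward_recurrence zsh mr.
have aA := ampleI (carrier_ample ok) aZ.
apply: (eventually_small aA.1 (short_measurable n)) => x [cx Zx].
have Yx := carrier_sub ok cx.
have rec (k : int) : exists2 j : int, k <= j & is_root s (sh j x).
  have [j kj rj] := hZ _ (aZ.2 (root_shift s x) x Zx) (root_roots ok cx)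
    (k - root_shift s x).
  by exists (j + root_shift s x); [lia|rewrite (shD zsh)].
have [J hJ] := tail_count_eventually zsh mk (E := is_root s) n Yx rec.
by exists J => j /hJ nt [_]; rewrite ltnNge nt.
Qed.

(** The order of choices matters: first M, which depends on s only, then the size n
of the groups, which bounds the mass of last_in_group by 1/n, and only then
the marker j that starts the grouping, because tails are short relative to n. *)
Lemma stage_step (m : nat) (eps : R) : (1 < m)%N -> 0 < eps ->
  exists t s', [/\ (0 < t)%N, stage_ok mu sh Y s', refines sh s s' (m ^ t) &
    mass [set x | ~~ same_root sh s' 1 x] < eps].
Proof.
move=> m1 e0.
have [M hM] : exists M, mass (far M) < eps / 2 by apply: far_small; rewrite divr_gt0.
pose K : R := (M.*2.+2)%:R; have K0 : 0 < K by rewrite ltr0n.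
pose del := eps / (K * 8); have d0 : 0 < del by rewrite divr_gt0// mulr_gt0.
pose t := (Num.truncn del^-1).+1.
have tn : del^-1 < (m ^ t)%:R.
  apply: (@lt_trans _ _ t%:R); first by rewrite truncnS_gt// invr_ge0 ltW.
  by rewrite ltr_nat; exact: ltn_expl.
have n0 : (0 < m ^ t)%N by rewrite expn_gt0; lia.
set n := (m ^ t)%N in tn n0.
have [J1 hJ1] := gap_small d0; have [J2 hJ2] := short_small n d0.
pose j := maxn J1 J2.
have [Y1 [aY1 gr]] := all_grouped zsh mk ok j n0.
pose s' := next_stage sh Y C s n j Y1.
have ok' : stage_ok mu sh Y s' by exact: (next_stage_ok zsh mk ok n0 aY1 gr).
have rf : refines sh s s' n by exact: (next_stage_refines zsh mk ok n0 aY1 gr).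
exists t, s'; split=> //.
have mlast : mass (last_in_group sh Y C s n j) < del.
  have lt : (n.-1 < num_labels s')%N.
    by have := num_labels_gt0 ok; rewrite /= -{2}(prednK n0); nia.
  have := slice_mass zsh mk ok' lt.
  have le1 : mass (last_in_group sh Y C s n j) <= mass (slice s' n.-1).
    apply: (mass_le_conull (carrier_ample ok').1 (last_measurable n j) (slice_measurable _ ok')).
    move=> x [[rx dx] cx]; split=> //=; have [_ rtx] := rootsP ok rx.
    by case/andP: rx => _ /eqP ->; rewrite rtx dx muln0.
  move=> h; rewrite -[del]invrK; apply: le_lt_trans (_ : (n%:R)^-1 < _); last first.
    by rewrite ltf_pV2 ?posrE ?invr_gt0// ltr0n.
  rewrite -[_^-1]mul1r ler_pdivlMr ?ltr0n// mulrC; apply: le_trans h.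
  apply: ler_pM => //; first exact: mass_ge0.
  by rewrite ler_nat /= leq_pmulr// (num_labels_gt0 ok).
have mobs : mass (obstacle sh Y C s n j) <= del * 3.
  apply: le_trans (massU _ _ _) _; [exact: measurableU (gap_measurable j) (last_measurable n j)|exact: short_measurable|].
  have := massU mu (gap_measurable j) (last_measurable n j).
  have := hJ1 j (leq_maxl _ _); have := hJ2 j (leq_maxr _ _); move: mlast; lra.
have mobs_sh i : mass (sh i @^-1` obstacle sh Y C s n j) <= del * 3.
  by rewrite (mass_sh zsh i (obstacle_measurable n j)).
have [mW Wle] := @mass_exists_seq _ _ _ mu _ (fun i => sh i @^-1` obstacle sh Y C s n j)
  (window M) (del * 3) (fun i => sh_measurable zsh i (obstacle_measurable n j))
  mobs_sh.
have mB : measurable [set x | ~~ same_root sh s' 1 x].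
  by apply: dm_measurable; apply: dm_comp; exact: (dm_same_root zsh 1 ok').
apply: le_lt_trans (mass_le_conull (carrier_ample ok').1 mB (measurableU _ _ (far_measurable M) mW) _) _.
  move=> x [/= nsr cx]; apply: contrapT => /not_orP[nf nw]; move: nsr => /negP; apply.
  apply/(same_rootP zsh mk _ ok' cx); apply: (same_group_near Y1 n0 cx.1 nf) => i iw ob.
  by apply: nw; exists i.
apply: le_lt_trans (massU _ (far_measurable M) mW) _.
have : (size (window M))%:R * (del * 3) = eps * 3 / 8.
  rewrite size_map size_iota -/K /del; field.
  by rewrite gt_eqF.
move: Wle hM => /[swap]; lra.
Qed.

End Estimate.

(** * Rotations with the same orbits *)

Section Rotation.
Context {R : realType} {d : measure_display} {X : measurableType d}.
Context {mu : probability X R} {sh : int -> X -> X} (zsh : zaction mu sh).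
Context {Y : set X} {C : nat -> set X} (mk : marked mu sh Y C).

Lemma first_stage_ok : stage_ok mu sh Y (Stage 1 (fun=> 0) (fun=> 0%N) Y).
Proof.
split=> //=.
- exact: dm_cst.
- exact: dm_cst.
- exact: (marked_ample mk).
- by move=> x _; rewrite /stage_root /= !(sh0 zsh).
- move=> x i Yx; rewrite ltnS leqn0 => /eqP ->; exists 0; split=> //.
  by rewrite (sh0 zsh).
- by move=> x y _ _; rewrite /stage_root /= !(sh0 zsh).
Qed.

Section OneStage.
Context {s : stage X} (ok : stage_ok mu sh Y s).
Context {A : set X} (mA : measurable A) (iA : shift_invariant sh A) (As : A `<=` carrier s).

(** Adds one to the label modulo the number of labels.  The set A is specified
independently of s, since it has to be common to all stages and, in the
application, invariant under a larger group. *)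
Definition rotation (s : stage X) (A : set X) (x : X) : X :=
  if `[< A x >] then
    sh (to_label sh s (fun y => ((label s y).+1 %% num_labels s)%N) x) x
  else x.

Local Notation tau := (rotation s A).
Local Notation N := (num_labels s).

Lemma rotation_out x : ~ A x -> tau x = x.
Proof. by move=> nA; rewrite /rotation asboolF. Qed.

Lemma rotation_orbit x : exists i, tau x = sh i x.
Proof.
rewrite /rotation; case: asboolP => _; first by eexists.
by exists 0; rewrite (sh0 zsh).
Qed.

Lemma rotation_in x : A x -> A (tau x).
Proof. by move=> Ax; have [i ->] := rotation_orbit x; exact: iA. Qed.

Lemma rotationP x : A x -> stage_root sh s (tau x) = stage_root sh s x /\
  label s (tau x) = ((label s x).+1 %% N)%N.
Proof.
move=> Ax; rewrite /rotation asboolT//.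
apply: (to_labelP zsh mk (f := fun y => ((label s y).+1 %% N)%N) ok (As Ax)).
by rewrite ltn_mod (num_labels_gt0 ok).
Qed.

Lemma iter_rotation_in n x : A x -> A (iter n tau x).
Proof. by move=> Ax; elim: n => //= n; exact: rotation_in. Qed.

Lemma iter_rotation n x : A x ->
  stage_root sh s (iter n tau x) = stage_root sh s x /\
  label s (iter n tau x) = ((label s x + n) %% N)%N.
Proof.
move=> Ax; elim: n => [|n [IHr IHl]] /=.
  by rewrite addn0 modn_small// (label_lt ok (As Ax)).
have [-> ->] := rotationP (iter_rotation_in n Ax).
by rewrite IHr IHl -addn1 modnDml addn1 addnS.
Qed.

Lemma iter_rotation_fixed n x : A x -> iter n tau x = x <-> (N %| n)%N.
Proof.
move=> Ax; have [rE lE] := iter_rotation n Ax; have lx := label_lt ok (As Ax).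
split=> [xE|/dvdnP[q nE]].
  move: lE; rewrite xE -[X in X = _](modn_small lx) -[X in (X %% N)%N = _]addn0 => /eqP.
  by rewrite eq_sym eqn_modDl mod0n.
apply: (label_inj ok) => //; [exact/As/iter_rotation_in|exact: As|].
by rewrite lE nE addnC modnMDl modn_small.
Qed.

Lemma iter_rotation_order x : iter N tau x = x.
Proof.
have [Ax|nA] := pselect (A x); first exact/(iter_rotation_fixed N Ax).
by elim: N => //= n ->; exact: rotation_out.
Qed.

Lemma rotation_inj : injective tau.
Proof.
move=> x y xy; rewrite -(iter_rotation_order x) -(iter_rotation_order y).
by rewrite -(prednK (num_labels_gt0 ok)) !iterSr xy.
Qed.

Lemma rotation_transitive k x : A x -> same_root sh s k x ->
  exists i, sh k x = iter i tau x.
Proof.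
move=> Ax /(same_rootP zsh mk k ok (As Ax)) rE.
have lx := label_lt ok (As Ax).
exists (N - label s x + label s (sh k x))%N.
set i := (_ + _)%N; have [rI lI] := iter_rotation i Ax.
have cI : carrier s (iter i tau x) by exact/As/iter_rotation_in.
apply: (label_inj ok _ cI); [exact/As/iA|by rewrite rI|].
rewrite lI /i addnA subnKC; last exact: ltnW.
by rewrite modnDl modn_small// (label_lt ok (As (iA k Ax))).
Qed.

Definition rotation_shift (x : X) : int :=
  if `[< A x >] then to_label sh s (fun y => ((label s y).+1 %% N)%N) x else 0.

Lemma rotation_shiftE x : tau x = sh (rotation_shift x) x.
Proof. by rewrite /rotation /rotation_shift; case: ifP => // _; rewrite (sh0 zsh). Qed.

Lemma dm_rotation_shift : dm rotation_shift.
Proof.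
apply: (dm_comp2 (fun (b : bool) (i : int) => if b then i else 0) (dm_asbool mA)).
apply: (dm_to_label zsh ok).
exact: (dm_comp (fun a => (a.+1 %% N)%N) (label_dm ok)).
Qed.

Lemma rotation_preimage B : measurable B -> measurable (tau @^-1` B).
Proof.
move=> mB; have := dm_sh_bind zsh (dm_asbool mB) dm_rotation_shift.
move=> /(_ [set true]); congr (measurable _); apply/seteqP; split=> x /=.
  by rewrite rotation_shiftE => /asboolP.
by rewrite rotation_shiftE => ?; apply/asboolP.
Qed.

(** Mass transport gives one inequality for every set; applied to the complement,
it gives the other. *)
Lemma rotation_preserving B : measurable B -> mu (tau @^-1` B) = mu B.
Proof.
have le B' : measurable B' -> mass mu (tau @^-1` B') <= mass mu B'.
  move=> mB; apply: (mass_transport zsh (rotation_preimage mB) mB dm_rotation_shift).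
    by move=> x; rewrite /= rotation_shiftE.
  by move=> x y _ _; rewrite -!rotation_shiftE; exact: rotation_inj.
move=> mB; have mtB := rotation_preimage mB.
rewrite !massE//; congr EFin; apply/eqP; rewrite eq_le le//=.
have := le _ (measurableC mB); rewrite preimage_setC.
have cmass D : measurable D -> mass mu (~` D) = 1 - mass mu D.
  move=> mD; apply: EFin_inj; rewrite -massE//; last exact: measurableC.
  by rewrite EFinB -massE// probability_setC.
by rewrite !cmass// lerD2l lerN2.
Qed.

End OneStage.

(** Advancing the label n * l + g of s' by n leads to n * (l + 1) + g, so within a
class of s' it advances the class of s by nothing and the label l by one. *)
Lemma rotation_refines (s s' : stage X) (n : nat) (A : set X) :
  stage_ok mu sh Y s -> stage_ok mu sh Y s' -> refines sh s s' n -> (0 < n)%N ->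
  shift_invariant sh A -> A `<=` carrier s' ->
  forall x, iter n (rotation s' A) x = rotation s A x.
Proof.
move=> ok ok' rf n0 iA As' x.
have As : A `<=` carrier s by apply: subset_trans As' (refines_carrier rf).
have [Ax|nA] := pselect (A x); last first.
  by rewrite rotation_out//; elim: n {rf n0} => //= n ->; exact: rotation_out.
have [g [gn lg rg]] := refines_label rf.
have [r1 l1] := iter_rotation ok' iA As' n Ax; have [r2 l2] := rotationP ok As Ax.
have Ay := rotation_in iA (s := s) Ax; have Az := iter_rotation_in iA (s := s') n Ax.
have gx := gn _ (As' _ Ax); have gz := gn _ (As' _ Az).
have lx := label_lt ok (As _ Ax).
have N0 := num_labels_gt0 ok.
move: l1; rewrite (lg _ (As' _ Az)) (lg _ (As' _ Ax)) (refines_order rf).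
rewrite -addnA [(g x + n)%N]addnC addnA -mulnSr => l1.
have key : (label s (iter n (rotation s' A) x) = (label s x).+1 %% num_labels s)%N /\
    g (iter n (rotation s' A) x) = g x.
  move: l1; set a := label s (iter _ _ _); set b := g (iter _ _ _) in gz *.
  have -> : ((n * (label s x).+1 + g x) %% (n * num_labels s) =
      n * ((label s x).+1 %% num_labels s) + g x)%N.
    rewrite {1}(divn_eq (label s x).+1 (num_labels s)) mulnDr -addnA.
    rewrite mulnCA modnMDl modn_small//.
    have h : ((label s x).+1 %% num_labels s < num_labels s)%N by rewrite ltn_mod.
    apply: (@leq_trans (n * ((label s x).+1 %% num_labels s) + n)%N).
      by rewrite ltn_add2l.
    by rewrite -mulnSr leq_mul2l h orbT.
  move=> E; have bg : b = g x.
    by have := congr1 (modn^~ n) E; rewrite /= ![(n * _)%N]mulnC !modnMDl !modn_small.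
  split=> //; apply/eqP; move: E; rewrite bg => /addIn/eqP.
  by rewrite eqn_mul2l => /orP[/eqP|//]; lia.
case: key => kl kg.
apply: (label_inj ok); [exact: As|exact: As| |by rewrite kl l2].
by rewrite r2; apply/(rg _ _ (As' _ Az) (As' _ Ax)).
Qed.

Lemma stage_sequence (m : nat -> nat) : (forall k, (1 < m k)%N) ->
  exists (s : nat -> stage X) (t : nat -> nat), [/\ num_labels (s 0%N) = 1%N,
   (forall k, stage_ok mu sh Y (s k)),
   (forall k, (0 < t k)%N), (forall k, refines sh (s k) (s k.+1) (m k ^ t k)) &
   forall k, mass mu [set x | ~~ same_root sh (s k.+1) 1 x] < k.+1%:R^-1].
Proof.
move=> m1; pose S := {s : stage X | stage_ok mu sh Y s}.
have step (ks : nat * S) : exists ts : nat * S, [/\ (0 < ts.1)%N,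
    refines sh (sval ks.2) (sval ts.2) (m ks.1 ^ ts.1) &
    mass mu [set x | ~~ same_root sh (sval ts.2) 1 x] < ks.1.+1%:R^-1].
  case: ks => k [s oks] /=.
  have e0 : 0 < k.+1%:R^-1 :> R by rewrite invr_gt0 ltr0n.
  have [t [s' [t0 ok' rf ms]]] := stage_step zsh mk oks (m1 k) e0.
  by exists (t, exist _ s' ok').
have [f hf] := choice step.
pose u := fix u k : S := if k is k'.+1 then (f (k', u k')).2
  else exist _ _ first_stage_ok.
exists (fun k => sval (u k)), (fun k => (f (k, u k)).1); split=> //.
- by move=> k; exact: (svalP (u k)).
- by move=> k; have [] := hf (k, u k).
- by move=> k; have [] := hf (k, u k).
- by move=> k; have [] := hf (k, u k).
Qed.

End Rotation.
Arguments rotation {d X} sh s A x.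

(** * Dye's theorem with prescribed prime factors *)

Record rotation_system (R : realType) (d : measure_display) (X : measurableType d)
    (mu : probability X R) (sh : int -> X -> X) (A : set X) (N : nat -> nat)
    (tau : nat -> X -> X) : Prop := {
  rs_out : forall k x, ~ A x -> tau k x = x;
  rs_orbit : forall k x, exists i, tau k x = sh i x;
  rs_fixed : forall k i x, A x -> iter i (tau k) x = x <-> (N k %| i)%N;
  rs_power : forall k, exists n, forall x, iter n (tau k.+1) x = tau k x;
  rs_transitive : forall x, A x -> exists k i, sh 1 x = iter i (tau k) x;
  rs_measurable : forall k B, measurable B -> measurable (tau k @^-1` B);
  rs_preserving : forall k B, measurable B -> mu (tau k @^-1` B) = mu B }.

Section Rotations.
Context {R : realType} {d : measure_display} {X : measurableType d}.
Context {mu : probability X R} {sh : int -> X -> X} (zsh : zaction mu sh).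

(** The stages have errors smaller than 1/(k + 1), so that almost every x shares
its class with T x at some stage.  The common domain A is left to the caller,
who needs it invariant under more than the action of the integers. *)
Theorem zaction_rotations (U : nat -> set X) (X0 : set X) (m : nat -> nat) :
  (forall n, measurable (U n)) ->
  (forall y z, (forall n, U n y <-> U n z) -> y = z) ->
  ample mu sh X0 -> (forall x i, X0 x -> sh i x = x -> i = 0) ->
  (forall k, (1 < m k)%N) ->
  exists (X1 : set X) (N : nat -> nat), [/\ ample mu sh X1 /\ X1 `<=` X0,
    N 0%N = 1%N,
    forall k, exists2 t, (0 < t)%N & N k.+1 = (m k ^ t * N k)%N &
    forall A, measurable A -> shift_invariant sh A -> A `<=` X1 ->
      exists tau, rotation_system mu sh A N tau].
Proof.
move=> mU sepU aX0 free m1.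
have [Y [aY YX0 Yrec Yvan]] := vanishing_markers zsh mU sepU aX0 free.
have mk : marked mu sh Y (marker sh U).
  split=> //.
  - by move=> x i /YX0; exact: free.
  - exact: (marker_measurable zsh mU).
  - by move=> n; exact: markerS.
have [s [t [s0 oks t0 rf ms]]] := stage_sequence zsh mk m1.
pose V : set X := [set x | exists k, same_root sh (s k.+1) 1 x].
have mbad k : measurable [set x | ~~ same_root sh (s k.+1) 1 x].
  by apply: dm_measurable; apply: dm_comp; exact: (dm_same_root zsh 1 (oks _)).
have mV : measurable V.
  by apply: measurable_exists => k; exact/dm_measurable/(dm_same_root zsh 1 (oks _)).
have cV : conull mu V.
  split=> //; apply/mass0P; first exact: measurableC.
  apply/eqP; rewrite eq_le mass_ge0 andbT leNgt; apply/negP => V0.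
  set c := mass mu (~` V) in V0; pose k := Num.truncn c^-1.
  have kc : c^-1 < k.+1%:R by rewrite truncnS_gt// invr_ge0 ltW.
  have : c < k.+1%:R^-1.
    apply: le_lt_trans (ms k); apply: mass_le => //; first exact: measurableC.
    by move=> x nV; apply/negP => h; apply: nV; exists k.
  by rewrite -[c]invrK ltf_pV2 ?posrE ?invr_gt0 ?ltr0n// ltNge (ltW kc).
pose X1 := orbitwise sh V `&` [set x | forall k, carrier (s k) x].
exists X1, (fun k => num_labels (s k)); split=> //.
- split; last by move=> x [_ /(_ 0%N)/(carrier_sub (oks 0%N))/YX0].
  apply: ampleI; last by apply: ample_forall => k; exact: (carrier_ample (oks k)).
  by split; [exact: (orbitwise_conull zsh)|exact: (orbitwise_invariant zsh)].
- by move=> k; exists (t k) => //; rewrite (refines_order (rf k)).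
move=> A mA iA AX1.
have Ak k : A `<=` carrier (s k) by move=> x /AX1[].
exists (fun k => rotation sh (s k) A); split.
- by move=> k x; exact: rotation_out.
- by move=> k x; exact: (rotation_orbit zsh).
- by move=> k i x Ax; exact: (iter_rotation_fixed zsh mk (oks k) iA (Ak k)).
- move=> k; exists (m k ^ t k)%N => x.
  apply: (rotation_refines zsh mk (oks k) (oks k.+1) (rf k)) => //.
  by rewrite expn_gt0; have := m1 k; lia.
- move=> x Ax; have [/(_ 0)] := AX1 x Ax; rewrite (sh0 zsh) => -[k sr] _.
  by exists k.+1; exact: (rotation_transitive zsh mk (oks k.+1) iA (Ak _)).
- by move=> k B; exact: (rotation_preimage zsh (oks k)).
- by move=> k B; exact: (rotation_preserving zsh mk (oks k)).
Qed.

End Rotations.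

(** * Groups of transformations *)

Record transformation_group (X : Type) (H : set (X -> X)) : Prop := {
  transf_id : H id;
  transf_comp : forall f g, H f -> H g -> H (f \o g);
  transf_inv : forall f, H f -> exists2 g, H g & cancel f g /\ cancel g f }.

Definition group_of (X : Type) (H : set (X -> X)) (hH : transformation_group H) : Type :=
  {f : X -> X | H f}.

Section GroupOf.
Context {X : Type} {H : set (X -> X)} (hH : transformation_group H).
Local Notation G := (group_of hH).

Lemma group_of_inj (f g : G) : sval f = sval g -> f = g.
Proof.
by case: f g => [f Hf] [g Hg] /= fg; subst g; congr exist; exact: Prop_irrelevance.
Qed.

Definition tg_one : G := exist _ id (transf_id hH).
Definition tg_mul (f g : G) : G :=
  exist _ (sval f \o sval g) (transf_comp hH (svalP f) (svalP g)).
Definition tg_inv (f : G) : G :=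
  let: exist2 g Hg _ := cid2 (transf_inv hH (svalP f)) in exist _ g Hg.

Lemma tg_mulA : associative tg_mul.
Proof. by move=> f g h; exact: group_of_inj. Qed.
Lemma tg_mul1 : left_id tg_one tg_mul.
Proof. by move=> f; exact: group_of_inj. Qed.
Lemma tg_mulr1 : right_id tg_one tg_mul.
Proof. by move=> f; exact: group_of_inj. Qed.
Lemma tg_mulV : left_inverse tg_one tg_inv tg_mul.
Proof.
move=> f; apply: group_of_inj; rewrite /= /tg_inv; case: cid2 => g Hg [fg gf] /=.
by apply/funext => x; exact: fg.
Qed.
Lemma tg_mulrV : right_inverse tg_one tg_inv tg_mul.
Proof.
move=> f; apply: group_of_inj; rewrite /= /tg_inv; case: cid2 => g Hg [fg gf] /=.
by apply/funext => x; exact: gf.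
Qed.

HB.instance Definition _ := gen_eqMixin G.
HB.instance Definition _ := gen_choiceMixin G.
HB.instance Definition _ :=
  isGroup.Build G tg_mulA tg_mul1 tg_mulr1 tg_mulV tg_mulrV.

Lemma group_of_expE (f : G) n x : sval (f ^+ n)%g x = iter n (sval f) x.
Proof. by elim: n x => [//|n IH] x; rewrite expgS /= IH -iterS. Qed.
End GroupOf.

Definition transf_groupType (X : Type) (H : set (X -> X))
  (hH : transformation_group H) : groupType := group_of hH.

(** * Integer powers and reduced words *)

Section IntegerPowers.
Local Open Scope group_scope.
Context {G : groupType}.

Definition zexp (g : G) (k : int) : G :=
  match k with Posz n => g ^+ n | Negz n => g ^- n.+1 end.

Lemma zexpS g k : zexp g (k + 1)%R = zexp g k * g.
Proof.
case: k => [n|[|n]].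
- by rewrite (_ : (Posz n + 1)%R = Posz n.+1) /= ?expgSr//; lia.
- by rewrite (_ : (Negz 0 + 1)%R = Posz 0) /= ?mulVg//; lia.
- rewrite (_ : (Negz n.+1 + 1)%R = Negz n); last lia.
  by rewrite /= [g ^+ n.+2]expgS invgM mulgVK.
Qed.

Lemma zexpB g k : zexp g (k - 1)%R = zexp g k * g^-1.
Proof. by rewrite -[in RHS](subrK 1%R k) zexpS mulgK. Qed.

Lemma zexpD g i j : zexp g (i + j)%R = zexp g i * zexp g j.
Proof.
elim/int_rec: j => [|n IH|n IH]; first by rewrite addr0 mulg1.
  by rewrite -addn1 PoszD addrA !zexpS IH mulgA.
by rewrite -addn1 PoszD opprD addrA !zexpB IH mulgA.
Qed.

Definition power_word (b : G) (k : int) : seq (G * bool) :=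
  match k with Posz n => nseq n (b, true) | Negz n => nseq n.+1 (b, false) end.

Lemma word_value_cons (l : G * bool) w : word_value (l :: w) = letter_value l * word_value w.
Proof. by rewrite /word_value big_cons. Qed.

Lemma word_value_cat (v w : seq (G * bool)) : word_value (v ++ w) = word_value v * word_value w.
Proof. by rewrite /word_value big_cat. Qed.

Lemma power_wordE b k : word_value (power_word b k) = zexp b k.
Proof.
have E n s : word_value (nseq n (b, s)) = letter_value (b, s) ^+ n.
  by elim: n => [|n IH]; rewrite /= ?word_value_cons ?IH ?expgS// /word_value big_nil.
by case: k => n; rewrite /power_word E//= /letter_value /= expVgn.
Qed.

Lemma power_word_cat b k (u : seq (G * bool)) : reduced u ->
  (forall l u', u = l :: u' -> l.1 != b) -> reduced (power_word b k ++ u).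
Proof.
move=> ru hu.
have E n s : reduced (nseq n (b, s) ++ u).
  elim: n => [//|[|n] IH] /=; last by rewrite /reduced /= !eqxx /=; exact: IH.
  case: u ru hu {IH} => [//|l u ru hu] /=.
  by rewrite /reduced /= eq_sym (hu l u erefl) /=; exact: ru.
by case: k => n; exact: E.
Qed.

Lemma power_word_nonempty b k : k != 0%R ->
  exists s u, power_word b k = (b, s) :: u.
Proof. by case: k => [[|n]|n] //= _; do 2!eexists. Qed.

Lemma mem_power_word b k l : l \in power_word b k -> l.1 = b.
Proof. by case: k => n /nseqP[->]. Qed.

End IntegerPowers.

(** * The group generated by the rotations and the rest of the basis *)

Lemma In_cat (T : Type) (x : T) (v w : seq T) :
  List.In x (v ++ w) <-> List.In x v \/ List.In x w.
Proof.
elim: v => [|y v IH] /=; first by split=> [|[]]; [right| |].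
by rewrite IH; tauto.
Qed.

Section WordAction.
Context {X : Type} {G : groupType} (act : G -> X -> X) (A : set X) (B : set G) (b0 : G).
Context (tau : nat -> X -> X) (N : nat -> nat).

Hypotheses (act1 : forall x, act 1%g x = x)
  (actM : forall g h x, act (g * h)%g x = act g (act h x))
  (iA : forall g x, A x -> A (act g x))
  (freeA : forall g x, A x -> act g x = x -> g = 1%g)
  (basis : free_basis B) (Bb0 : B b0)
  (tau_out : forall k x, ~ A x -> tau k x = x)
  (tau_orbit : forall k x, exists i, tau k x = act (zexp b0 i) x)
  (N_gt0 : forall k, (0 < N k)%N)
  (tau_fixed : forall k i x, A x -> iter i (tau k) x = x <-> (N k %| i)%N)
  (tau_power : forall k, exists n, forall x, iter n (tau k.+1) x = tau k x)
  (tau_transitive : forall x, A x -> exists k i, act b0 x = iter i (tau k) x).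

(** inl (k, i) stands for the i-th power of tau k; no negative powers are needed,
because tau k has finite order. *)
Definition letter : Type := ((nat * nat) + (G * bool))%type.

Definition letter_map (l : letter) (x : X) : X :=
  match l with
  | inl (k, i) => iter i (tau k) x
  | inr p => if `[< A x >] then act (letter_value p) x else x
  end.

Definition word_map (w : seq letter) (x : X) : X := foldr letter_map x w.

Definition proper (l : letter) : Prop :=
  if l is inr p then B p.1 /\ p.1 <> b0 else True.

Definition nontrivial (l : letter) : Prop :=
  if l is inl (k, i) then ~ (N k %| i)%N else True.

(** A word is in normal form when no two adjacent letters are powers of rotations
or inverse to each other. *)
Definition compatible (l l' : letter) : bool :=
  match l, l' with
  | inl _, inl _ => false
  | inr p, inr q => (p.1 != q.1) || (p.2 == q.2)
  | _, _ => true
  end.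

Definition word_ok (w : seq letter) : Prop := forall l, List.In l w -> proper l.
Definition normal (w : seq letter) : Prop :=
  sorted compatible w /\ forall l, List.In l w -> nontrivial l.

Lemma iter_tau_orbit n k x : exists i, iter n (tau k) x = act (zexp b0 i) x.
Proof.
elim: n => [|n [i IH]]; first by exists 0; rewrite act1.
have [j jE] := tau_orbit k (act (zexp b0 i) x).
by exists (j + i); rewrite iterS IH jE zexpD actM.
Qed.

Lemma iter_tau_out n k x : ~ A x -> iter n (tau k) x = x.
Proof. by move=> nA; elim: n => //= n ->; exact: tau_out. Qed.

Lemma letter_map_orbit l x : exists g, letter_map l x = act g x.
Proof.
case: l => [[k i]|p] /=.
  by have [j ->] := iter_tau_orbit i k x; eexists.
by case: asboolP => _; eexists; rewrite // act1.
Qed.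

Lemma letter_map_in l x : A x -> A (letter_map l x).
Proof. by move=> Ax; have [g ->] := letter_map_orbit l x; exact: iA. Qed.

Lemma word_map_cat v w x : word_map (v ++ w) x = word_map v (word_map w x).
Proof. by rewrite /word_map foldr_cat. Qed.

Lemma word_map_in w x : A x -> A (word_map w x).
Proof. by move=> Ax; elim: w => //= l w; exact: letter_map_in. Qed.

Lemma word_map_orbit w x : exists g, word_map w x = act g x.
Proof.
elim: w => [|l w [g IH]] /=; first by exists 1%g; rewrite act1.
have [h hE] := letter_map_orbit l (word_map w x).
by exists (h * g)%g; rewrite hE IH actM.
Qed.

(** At a given point, a nontrivial power of tau k acts like a power of b0, and the
exponent, which depends on the point, is nonzero because tau k moves that
point.  The letters next to it in the normal form are not powers of b0, so the
concatenation of these words over B is reduced.  The last clause records the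
first letter, which is what the induction needs. *)
Lemma normal_word_translation w x : A x -> word_ok w -> normal w ->
  exists u, [/\ reduced u, (forall l, l \in u -> B l.1),
    word_map w x = act (word_value u) x &
    match w with
    | [::] => u = [::]
    | inl _ :: _ => exists s u', u = (b0, s) :: u'
    | inr p :: _ => exists u', u = p :: u'
    end].
Proof.
move=> Ax; elim: w => [|l w IH] wok [sw nw].
  by exists [::]; split=> //; rewrite /word_value big_nil act1.
have wok' : word_ok w by move=> l' h; apply: wok; right.
have nw' : normal w.
  split; last by move=> l' h; apply: nw; right.
  by move: sw => /= /path_sorted.
have [u [ru uB uE hu]] := IH wok' nw'.
have Aw := word_map_in w Ax.
have pl := wok l (or_introl erefl); have nl := nw l (or_introl erefl).
case: l pl nl sw {wok nw} => [[k i]|p] pl nl sw.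
  have [j jE] := iter_tau_orbit i k (word_map w x).
  have j0 : j != 0.
    apply/eqP => j0; apply: nl; apply/(tau_fixed k i Aw).
    by rewrite jE j0 act1.
  exists (power_word b0 j ++ u); split.
  - apply: power_word_cat => // l u' uE'; apply/eqP => lb.
    case: w sw hu wok' {IH nw' Aw uE jE} => [_ h _|[q|p] w //]; first by rewrite h in uE'.
    move=> _ [u2 h] /(_ (inr p) (or_introl erefl)) [_]; apply.
    by move: uE'; rewrite h => -[-> _].
  - by move=> l; rewrite mem_cat => /orP[/mem_power_word ->//|]; exact: uB.
  - by rewrite /= jE uE word_value_cat actM power_wordE.
  - have [s [u' ->]] := power_word_nonempty b0 j0.
    by exists s, (u' ++ u).
exists (p :: u); split.
- rewrite /reduced /=.
  case: w sw hu {IH wok' nw' Aw uE} => [_ -> //|[q|q] w] sw.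
    move=> [s [u' uE]]; rewrite uE in ru *; move: ru; rewrite /reduced /= => ->; rewrite andbT.
    by case: pl => _ /eqP ->.
  move=> [u' uE]; rewrite uE in ru *; move: ru; rewrite /reduced /= => ->; rewrite andbT.
  by move: sw => /= /andP[].
- by move=> l; rewrite inE => /predU1P[->|]; [case: pl|exact: uB].
- by rewrite /= asboolT// uE word_value_cons actM.
- by exists u.
Qed.

Lemma reduced_word_neq1 u : reduced u -> (forall l, l \in u -> B l.1) ->
  u <> [::] -> word_value u <> 1%g.
Proof.
move=> ru uB u0 u1; apply: u0; have [v [_ uniqv]] := basis 1%g.
rewrite -(uniqv u) ?(uniqv [::])//; split=> //.
by rewrite /word_value big_nil.
Qed.

Lemma normal_word_free w x : A x -> word_ok w -> normal w -> w <> [::] ->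
  word_map w x <> x.
Proof.
move=> Ax wok nw w0; have [u [ru uB uE hu]] := normal_word_translation Ax wok nw.
rewrite uE => /(freeA Ax); apply: reduced_word_neq1 => //.
by case: w w0 hu {wok nw uE} => [//|[q|q] w] _; [move=> [s [u' ->]]|move=> [u' ->]].
Qed.

Lemma tau_common k l : (k <= l)%N -> exists n, forall x, iter n (tau l) x = tau k x.
Proof.
move=> kl; rewrite -(subnK kl); elim: (l - k)%N => [|m [n IH]]; first by exists 1%N.
have [q hq] := tau_power (m + k); exists (n * q)%N => x.
rewrite addSn -IH {IH}; elim: n => [//|n IH].
by rewrite mulSn iterD IH iterS hq.
Qed.

Lemma iter_tau_id k i : (N k %| i)%N -> forall x, iter i (tau k) x = x.
Proof.
move=> h x; have [Ax|nA] := pselect (A x); first exact/(tau_fixed k i Ax).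
exact: iter_tau_out.
Qed.

(** Any two rotations are powers of a common one, so two powers of rotations merge
into one.  The last clause keeps the rest of a normal word normal after the
merger. *)
Lemma merge_letters l l' : proper l -> proper l' -> ~~ compatible l l' ->
  (forall x, letter_map l (letter_map l' x) = x) \/
  exists q, [/\ nontrivial (inl q),
    forall x, letter_map l (letter_map l' x) = letter_map (inl q) x &
    forall p, compatible l' p = compatible (inl q) p].
Proof.
case: l => [[k i]|p] /= pl; case: l' => [[k' i']|q] //= pl'.
  move=> _; have [n hn] := tau_common (leq_maxl k k').
  have [n' hn'] := tau_common (leq_maxr k k').
  pose m := maxn k k'; pose c := (i * n + i' * n')%N.
  have iterE a b f g (x : X) : (forall x, iter b f x = g x) ->
      iter a g x = iter (a * b) (f : X -> X) x.
    by move=> h; elim: a x => [//|a IH] x; rewrite mulSn iterD -IH iterS h.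
  have E x : iter i (tau k) (iter i' (tau k') x) = iter c (tau m) x.
    by rewrite (iterE i n _ _ _ hn) (iterE i' n' _ _ _ hn') -iterD.
  have [h|h] := boolP (N m %| c)%N; [left|right].
    by move=> x; rewrite E; exact: iter_tau_id.
  by exists (m, c); split=> //; exact/negP.
rewrite negb_or negbK => /andP[/eqP pq sq]; left=> x.
have [Ax|nA] := pselect (A x); last by rewrite !(asboolF nA).
rewrite (asboolT Ax) asboolT; last exact: iA.
rewrite -actM (_ : (_ * _)%g = 1%g) ?act1// /letter_value pq.
by case: p.2 q.2 sq => [] [] //= _; rewrite ?mulgV ?mulVg.
Qed.

Lemma word_normal_form w : word_ok w -> exists w', [/\ word_ok w', normal w',
  (size w' <= size w)%N & forall x, word_map w' x = word_map w x].
Proof.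
elim: w => [|l w IH] wok; first by exists [::].
have [|w' [wok' nw' sz wE]] := IH; first by move=> l' h; apply: wok; right.
have pl := wok l (or_introl erefl).
case: w' wok' nw' sz wE => [|h t] wok' [sw nw] sz wE.
  have [nl|nl] := pselect (nontrivial l).
    exists [:: l]; split=> //; [by move=> l' [<-|//]|split=> // l' [<-//|//]|].
    by move=> x /=; rewrite -wE.
  exists [::]; split=> // x; rewrite /= -wE /=.
  by case: l pl nl {wok} => [[k i]|p] //= _ /contrapT h; rewrite iter_tau_id.
have ph := wok' h (or_introl erefl).
have tok : word_ok t by move=> l' ?; apply: wok'; right.
have nt : normal t.
  split; last by move=> l' ?; apply: nw; right.
  by move: sw => /= /path_sorted.
have [nl|nl] := pselect (nontrivial l); last first.
  exists (h :: t); split=> //; first exact: leq_trans sz _.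
  move=> x; rewrite wE /=.
  by case: l pl nl {wok} => [[k i]|p] //= _ /contrapT ?; rewrite iter_tau_id.
have [c|nc] := boolP (compatible l h).
  exists [:: l, h & t]; split=> //.
  - by move=> l' [<-//|?]; exact: wok'.
  - split; first by rewrite /= c.
    by move=> l' [<-//|?]; exact: nw.
  - by move=> x /=; rewrite -wE.
have [E|[q [nq E cq]]] := merge_letters pl ph nc.
  exists t; split=> //; first by rewrite /= in sz *; lia.
  by move=> x /=; rewrite -wE /= E.
exists (inl q :: t); split=> //.
- by move=> l' [<-//|?]; exact: tok.
- split; last by move=> l' [<-//|?]; exact: nt.2.
  by case: t sw {wok' nw sz wE tok nt} => [//|a t] /=; rewrite cq.
- by rewrite /= in sz *; lia.
- by move=> x; rewrite /= -wE /= E.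
Qed.

Definition generated_maps : set (X -> X) :=
  [set f | exists2 w, word_ok w & f = word_map w].

Definition inverse_letter (l : letter) : letter :=
  match l with
  | inl (k, i) => inl (k, (i * (N k).-1)%N)
  | inr (b, s) => inr (b, ~~ s)
  end.

Lemma inverse_letter_proper l : proper l -> proper (inverse_letter l).
Proof. by case: l => [[k i]|[b s]]. Qed.

Lemma inverse_letterK l : cancel (letter_map l) (letter_map (inverse_letter l)) /\
  cancel (letter_map (inverse_letter l)) (letter_map l).
Proof.
case: l => [[k i]|[b s]]; split=> x /=.
- by rewrite -iterD iter_tau_id// -mulnSr prednK// dvdn_mull.
- by rewrite -iterD addnC iter_tau_id// -mulnSr prednK// dvdn_mull.
- have [Ax|nA] := pselect (A x); last by rewrite !(asboolF nA).
  rewrite (asboolT Ax) asboolT; last exact: iA.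
  by rewrite -actM /letter_value /=; case: s => /=; rewrite ?mulgV ?mulVg act1.
- have [Ax|nA] := pselect (A x); last by rewrite !(asboolF nA).
  rewrite (asboolT Ax) asboolT; last exact: iA.
  by rewrite -actM /letter_value /=; case: s => /=; rewrite ?mulgV ?mulVg act1.
Qed.

Lemma generated_maps_group : transformation_group generated_maps.
Proof.
split.
- by exists [::].
- move=> _ _ [v vok ->] [w wok ->]; exists (v ++ w).
    by move=> l /In_cat[/(vok l)|/(wok l)].
  by apply/funext => x /=; rewrite word_map_cat.
- move=> _ [w wok ->].
  suff [v [vok vw wv]] : exists v, [/\ word_ok v,
      cancel (word_map w) (word_map v) & cancel (word_map v) (word_map w)].
    by exists (word_map v); first by exists v.
  elim: w wok => [|l w IH] wok; first by exists [::].
  have [|v [vok vw wv]] := IH; first by move=> l' h; apply: wok; right.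
  have [lK Kl] := inverse_letterK l.
  exists (v ++ [:: inverse_letter l]); split.
  - move=> l' /In_cat[/(vok l')//|[<-|//]].
    by apply: inverse_letter_proper; apply: wok; left.
  - by move=> x; rewrite word_map_cat /= lK vw.
  - by move=> x; rewrite word_map_cat /= wv Kl.
Qed.

Lemma generated_map_free f x : generated_maps f -> A x -> f x = x -> f = id.
Proof.
move=> [w wok ->] Ax; have [w' [wok' nw' _ wE]] := word_normal_form wok.
rewrite -wE => fx; apply/funext => y; rewrite -wE.
have [->//|w0] := pselect (w' = [::]).
by case: (normal_word_free Ax wok' nw' w0).
Qed.

Lemma generated_orbit x : A x ->
  [set f x | f in generated_maps] = [set act g x | g in [set: G]].
Proof.
move=> Ax; apply/seteqP; split=> y.
  move=> [_ [w _ ->] <-]; have [g ->] := word_map_orbit w x; by exists g.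
move=> [g _ <-]; have [u [[ru uB <-] _]] := basis g.
suff [w wok wE] : exists2 w, word_ok w & word_map w x = act (word_value u) x.
  by exists (word_map w) => //; exists w.
elim: u uB {ru} => [|p u IH] uB.
  by exists [::] => //; rewrite /word_value big_nil act1.
have [|w wok wE] := IH; first by move=> l lu; apply: uB; rewrite inE lu orbT.
rewrite word_value_cons actM -wE.
have Aw := word_map_in w Ax; set z := word_map w x in Aw wE *.
have [l pl lE] : exists2 l, proper l & letter_map l z = act (letter_value p) z.
  have [pb|pb] := pselect (p.1 = b0); last first.
    exists (inr p); last by rewrite /= asboolT.
    by split=> //; apply: uB; rewrite mem_head.
  have st v : A v -> exists k i, act b0 v = iter i (tau k) v by exact: tau_transitive.
  case: p pb uB => [b [] /=] -> _; rewrite /letter_value /=.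
    by have [k [i ->]] := st z Aw; exists (inl (k, i)).
  have [k [i iE]] := st (act b0^-1%g z) (iA _ Aw).
  exists (inverse_letter (inl (k, i))) => //.
  rewrite -[z in LHS](act1 z) -(mulgV b0) actM iE.
  by have [lK _] := inverse_letterK (inl (k, i)); exact: lK.
exists (l :: w); last by rewrite /= lE.
by move=> l' [<-//|h]; exact: wok.
Qed.

Lemma cyclic_word_power (r : rel letter) l t n : path r l t -> r (last l t) l ->
  forall x, r x l -> path r x (flatten (nseq n (l :: t))).
Proof.
move=> plt rl; elim: n => [//|n IH] x xl /=.
by rewrite cat_path xl plt /=; exact: IH.
Qed.

Lemma word_map_power n w x : word_map (flatten (nseq n w)) x = iter n (word_map w) x.
Proof. by elim: n => //= n IH; rewrite word_map_cat IH. Qed.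

(** All powers of a cyclically normal word are normal, so it has infinite order.
Any other normal word with at least two letters becomes shorter when its last
letter is conjugated to the front, which leaves a power of some tau k; and N k
is prime to p. *)
Lemma generated_torsion p w : (exists x, A x) -> prime p ->
  (forall k, ~ (p %| N k)%N) -> word_ok w ->
  (forall x, iter p (word_map w) x = x) -> forall x, word_map w x = x.
Proof.
move=> [x0 Ax0] pp pN; elim: {w}(size w) {-2}w (leqnn (size w)) => [|n IH] w.
  by rewrite leqn0 size_eq0 => /eqP ->.
move=> sz wok wp; have [w' [wok' nw' sz' wE]] := word_normal_form wok.
case: w' wok' nw' sz' wE => [|l t] wok' nw' sz' wE; first by move=> x; rewrite -wE.
have w'p x : iter p (word_map (l :: t)) x = x by rewrite -[RHS]wp; apply: eq_iter.
have [cl|ncl] := boolP (compatible (last l t) l).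
  have p0 := prime_gt0 pp; have [sw nw] := nw'.
  have fl q l' : List.In l' (flatten (nseq q (l :: t))) -> List.In l' (l :: t).
    by elim: q => [//|q IHq] /= [->|/In_cat[?|/IHq]]; [left|right|].
  case: (@normal_word_free (flatten (nseq p (l :: t))) x0 Ax0).
  - by move=> l' /fl; exact: wok'.
  - split; last by move=> l' /fl; exact: nw.
    rewrite -(prednK p0) /= cat_path; apply/andP; split=> //.
    exact: cyclic_word_power.
  - by rewrite -(prednK p0).
  - by rewrite word_map_power.
case/lastP: t wok' nw' sz' wE w'p ncl => [|t z] wok' nw' sz' wE w'p ncl.
  case: l wok' nw' {sz'} wE w'p ncl => [[k i]|q] wok' nw' wE w'p; last by rewrite /= !eqxx.
  move=> _; case: (nw'.2 (inl (k, i)) (or_introl erefl)).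
  have : iter (i * p) (tau k) x0 = x0.
    rewrite -[RHS](w'p x0).
    have it q : iter (i * q) (tau k) x0 = iter q (word_map [:: inl (k, i)]) x0.
      by elim: q => [|q IHq]; rewrite ?muln0// mulnS iterD IHq.
    exact: it.
  move=> /(tau_fixed k (i * p) Ax0); rewrite Gauss_dvdl// coprime_sym prime_coprime//.
  exact/negP.
rewrite last_rcons in ncl.
have pz : proper z by apply: wok'; rewrite -cats1; right; apply/In_cat; right; left.
have pl : proper l by apply: wok'; left.
have tok : word_ok t.
  by move=> l' h; apply: wok'; rewrite -cats1; right; apply/In_cat; left.
have [zK Kz] := inverse_letterK z.
have [v [vok vsz vE]] : exists v, [/\ word_ok v, (size v <= (size t).+1)%N &
    forall x, word_map v x = letter_map z (word_map (l :: t) x)].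
  have [E|[q [nq E _]]] := merge_letters pz pl ncl.
    by exists t; split=> // x; rewrite /= E.
  by exists (inl q :: t); split=> //; [move=> l' [<-//|]; exact: tok|move=> x; rewrite /= E].
have conj x : word_map v (letter_map z x) = letter_map z (word_map (l :: rcons t z) x).
  by rewrite vE -cats1 -cat_cons word_map_cat.
have vp x : iter p (word_map v) x = x.
  rewrite -(Kz x); set y := letter_map _ x; rewrite -[in RHS](w'p y).
  have it q : iter q (word_map v) (letter_map z y) =
      letter_map z (iter q (word_map (l :: rcons t z)) y).
    by elim: q => [//|q IHq]; rewrite iterS IHq conj.
  exact: it.
have vid x : word_map v x = x.
  apply: IH => //; apply: leq_trans vsz _.
  by move: sz' sz; rewrite /= size_rcons; lia.
by move=> x; rewrite -wE -[RHS]zK -[in RHS](vid (letter_map z x)) conj zK.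
Qed.

End WordAction.

(** * Separating sets in a standard Borel space *)

Section StandardBorel.
Context {R : realType} {d : measure_display} {X : measurableType d}.

(** The interiors of balls of radius 2 / (k + 1) around the points of a countable
dense set; phi numbers these points. *)
Lemma standard_borel_separating : standard_borel R X ->
  exists U : nat -> set X, (forall n, measurable (U n)) /\
    forall y z, (forall n, U n y <-> U n z) -> y = z.
Proof.
move=> [T [hausT [D /countable_injP[phi phi_inj] denseD]] [f bij_f mf]].
pose rad k : R := k.+1%:R^-1.
have rad0 k : 0 < rad k by rewrite invr_gt0 ltr0n.
pose V m k : set T := \bigcup_(c in D `&` phi @^-1` [set m]) (ball c (rad k + rad k))°.
pose U n : set X := if unpickle n is Some (m, k) then f @^-1` (V m k) else set0.
exists U; split.
  move=> n; rewrite /U; case: unpickle => [[m k]|//]; apply/mf.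
  by apply: sub_gen_smallest; apply: bigcup_open => c _; exact: open_interior.
move=> y z Uyz; apply: (bij_inj bij_f); apply: contrapT => /eqP fyz.
have := hausT; rewrite ball_hausdorff => /(_ _ _ fyz)[[r1 r2] /= /eqP r12].
have [k kr] : exists k, rad k + rad k + rad k < r1%:num.
  exists (Num.truncn (r1%:num / 3)^-1).
  set k := Num.truncn _.
  have h : (r1%:num / 3)^-1 < k.+1%:R by rewrite truncnS_gt// invr_ge0 divr_ge0.
  have : rad k < r1%:num / 3.
    by rewrite -[X in _ < X]invrK ltf_pV2 ?posrE ?ltr0n ?invr_gt0 ?divr_gt0.
  lra.
have [c [cy Dc]] : (ball (f y) (rad k))° `&` D !=set0.
  apply: denseD; last exact: open_interior.
  by exists (f y); apply: nbhsx_ballx.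
have {}cy : ball (f y) (rad k) c by exact: interior_subset.
have Uy : U (pickle (phi c, k)) y.
  rewrite /U pickleK; exists c => //.
  apply: (@filterS _ _ _ (ball (f y) (rad k))); last exact: nbhsx_ballx.
  by move=> w; apply: ball_triangle; exact: ball_sym.
have := (Uyz (pickle (phi c, k))).1 Uy; rewrite /U pickleK => -[c' [Dc' cc'] fz].
have cE : c' = c by apply: phi_inj => //; rewrite ?inE.
rewrite cE in fz; have {}fz := interior_subset fz.
have : (ball (f y) r1%:num `&` ball (f z) r2%:num) (f z).
  split; last exact: ballxx.
  apply: (le_ball (ltW kr)); rewrite addrC [rad k + _]addrC addrA.
  by rewrite -addrA; exact: ball_triangle cy fz.
by rewrite r12.
Qed.

Context {mu : probability X R}.

Lemma conull_forall_countable (I : Type) (F : I -> set X) :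
  countable [set: I] -> (forall i, conull mu (F i)) ->
  conull mu [set x | forall i, F i x].
Proof.
move=> /countable_injP[phi phi_inj] cF.
pose E (n : nat) : set X := [set x | forall i, phi i = n -> F i x].
have -> : [set x | forall i, F i x] = [set x | forall n, E n x].
  by apply/seteqP; split=> x /= h; [move=> n i _; exact: h|move=> i; exact: (h (phi i))].
apply: conull_forall => n; have [[i iE]|nE] := pselect (exists i, phi i = n).
  have -> : E n = F i; last exact: cF.
  apply/seteqP; split=> x; first by move=> /(_ i iE).
  by move=> Fx j jE; rewrite (phi_inj j i) ?inE// jE iE.
have -> : E n = setT by apply/seteqP; split=> x // _ i iE; case: nE; exists i.
by split; rewrite ?setCT.
Qed.
End StandardBorel.

(** * Primes *)

Fixpoint nth_prime (n : nat) : nat :=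
  if n is n'.+1 then s2val (prime_above (nth_prime n')) else 2.

Lemma nth_prime_prime n : prime (nth_prime n).
Proof. by case: n => [//|n] /=; case: prime_above. Qed.

Lemma nth_prime_inj : injective nth_prime.
Proof.
have lt i j : (i < j)%N -> (nth_prime i < nth_prime j)%N.
  elim: j => [//|j IH]; rewrite ltnS leq_eqVlt => /predU1P[->|/IH h] /=.
    by case: prime_above.
  by apply: ltn_trans h _; case: prime_above.
move=> i j ij; have [/lt|/lt|//] := ltngtP i j; by rewrite ij ltnn.
Qed.

(** The factor 2 keeps the multiplier greater than 1 when S is empty. *)
Definition multiplier (S : nat -> bool) (k : nat) : nat :=
  (2 * \prod_(i < k | S i) nth_prime i.+1)%N.

Lemma multiplier_gt1 S k : (1 < multiplier S k)%N.
Proof.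
have : (0 < \prod_(i < k | S i) nth_prime i.+1)%N.
  by apply: prodn_cond_gt0 => i _; exact/prime_gt0/nth_prime_prime.
by rewrite /multiplier; lia.
Qed.

Lemma dvd_multiplier S n : (exists k, nth_prime n.+1 %| multiplier S k)%N <-> S n.
Proof.
have pn := nth_prime_prime n.+1; split.
  move=> [k]; rewrite /multiplier Euclid_dvdM// => /orP[|].
    rewrite dvdn_prime2// => /eqP/esym; rewrite -[2%N]/(nth_prime 0).
    by move=> /nth_prime_inj.
  rewrite Euclid_dvd_prod// big_orE => /exists_inP[i Si].
  rewrite dvdn_prime2 ?nth_prime_prime// => /eqP/nth_prime_inj [->].
  exact: Si.
move=> Sn; exists n.+1; apply: dvdn_mull.
by rewrite (bigD1 ord_max)//=; exact: dvdn_mulr.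
Qed.

Lemma nat_bool_uncountable : ~ countable [set: nat -> bool].
Proof.
move=> /countable_injP[f f_inj].
pose G n := ~~ `[< exists F : nat -> bool, f F = n /\ F n >].
have [GG|nGG] := boolP (G (f G)).
  by have := GG; rewrite /G => /asboolPn; apply; exists G.
have := nGG; rewrite /G negbK => /asboolP[F [fF]].
have -> : F = G by apply: f_inj; rewrite ?inE.
by rewrite (negbTE nGG).
Qed.

Lemma dvd_orders (m N : nat -> nat) p : prime p -> N 0%N = 1%N ->
  (forall k, exists2 t, (0 < t)%N & N k.+1 = (m k ^ t * N k)%N) ->
  (exists k, p %| N k)%N <-> (exists k, p %| m k)%N.
Proof.
move=> pp N0 NS; split.
  move=> [k]; elim: k => [|k IH].
    by rewrite N0 dvdn1 => /eqP p1; move: pp; rewrite p1.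
  have [t t0 ->] := NS k; rewrite Euclid_dvdM// => /orP[|//].
  by rewrite Euclid_dvdX// => /andP[h _]; exists k.
move=> [k pk]; exists k.+1; have [t t0 ->] := NS k.
apply: dvdn_mulr; apply: dvdn_trans pk _.
by rewrite -[m k in X in (X %| _)%N]expn1 dvdn_exp2l.
Qed.

(** * Torsion primes *)

Definition torsion_prime (G : groupType) (p : nat) : Prop :=
  exists x : G, x <> 1%g /\ (x ^+ p)%g = 1%g.

Lemma torsion_prime_isomorphic (G H : groupType) p :
  group_isomorphic G H -> torsion_prime G p -> torsion_prime H p.
Proof.
move=> [f [bf fM]] [x [x1 xp]].
have f1 : f 1%g = 1%g by apply: (mulgI (f 1%g)); rewrite -fM !mulg1.
have fX n : f (x ^+ n)%g = (f x ^+ n)%g.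
  by elim: n => [//|n IH]; rewrite !expgS fM IH.
exists (f x); split; last by rewrite -fX xp.
by move=> fx; apply: x1; apply: (bij_inj bf); rewrite fx.
Qed.

Lemma group_isomorphic_sym (G H : groupType) :
  group_isomorphic G H -> group_isomorphic H G.
Proof.
move=> [f [[g fg gf] fM]]; exists g; split; first by exists f.
by move=> x y; apply: (can_inj fg); rewrite fM !gf.
Qed.

(** * Orbit equivalent actions *)

Section FreeBasis.
Context {G : groupType} {B : set G} (basis : free_basis B).

Lemma free_basis_nonempty : (exists g : G, g <> 1%g) -> exists b, B b.
Proof.
move=> [g g1]; have [[|[b s] w] [[_ wB wg] _]] := basis g.
  by case: g1; rewrite -wg /word_value big_nil.
by exists b; apply: (wB (b, s)); rewrite mem_head.
Qed.

Lemma zexp_eq1 b k : B b -> zexp b k = 1%g -> k = 0.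
Proof.
move=> Bb bk; apply/eqP; apply: contrapT => /negP k0.
apply: (reduced_word_neq1 basis (u := power_word b k)).
- by have := @power_word_cat _ b k [::]; rewrite cats0; apply.
- by move=> l /mem_power_word ->.
- by have [s [u ->]] := power_word_nonempty b k0.
- by rewrite power_wordE.
Qed.
End FreeBasis.

Section GeneratedMeasurability.
Context {R : realType} {d : measure_display} {X : measurableType d}.
Context {mu : probability X R} {G : groupType} {act : G -> X -> X}.
Context (pa : probability_action mu act).

Lemma act_preimage g D : measurable D -> measurable (act g @^-1` D).
Proof. by move=> mD; rewrite -[X in measurable X]setTI; exact: (action_measurable pa g). Qed.

Lemma conull_act g A : conull mu A -> conull mu (act g @^-1` A).
Proof.
move=> [mA A0]; split; first exact: act_preimage.
by rewrite preimage_setC (action_preserving pa)//; exact: measurableC.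
Qed.

Lemma act_zaction b : zaction mu (fun k => act (zexp b k)).
Proof.
split.
- exact: (action1 pa).
- by move=> i j x; rewrite zexpD (actionM pa).
- by move=> i D; exact: act_preimage.
- by move=> i D; exact: (action_preserving pa).
Qed.

Definition preserving (f : X -> X) : Prop := forall D, measurable D ->
  measurable (f @^-1` D) /\ mu (f @^-1` D) = mu D.

Lemma preserving_iter f n : preserving f -> preserving (iter n f).
Proof.
move=> pf; elim: n => [|n IH] D mD; first by rewrite preimage_id.
have [m1 e1] := pf D mD; have [m2 e2] := IH _ m1.
by rewrite [_ @^-1` _](_ : _ = iter n f @^-1` (f @^-1` D))// e2.
Qed.

Lemma mass_eq_conull Y D E : conull mu Y -> measurable D -> measurable E ->
  (forall x, Y x -> D x <-> E x) -> mu D = mu E.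
Proof.
move=> cY mD mE DE; rewrite !massE//; congr EFin; apply/eqP; rewrite eq_le.
by apply/andP; split; apply: (mass_le_conull cY) => // x [h Yx]; apply/(DE x Yx).
Qed.

Lemma generated_preserving A B b0 tau f : conull mu A ->
  (forall k, preserving (tau k)) ->
  generated_maps act A B b0 tau f -> preserving f.
Proof.
move=> cA ptau [w _ ->]; elim: w => [|l w IH] D mD; first by rewrite preimage_id.
suff [m1 e1] : measurable (letter_map act A tau l @^-1` D) /\
    mu (letter_map act A tau l @^-1` D) = mu D.
  have [m2 e2] := IH _ m1.
  by rewrite [_ @^-1` _](_ : _ =
    word_map act A tau w @^-1` (letter_map act A tau l @^-1` D))// e2.
case: l => [[k i]|p]; first exact: (preserving_iter i (ptau k)).
have mp := act_preimage (letter_value p) mD.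
have EP : letter_map act A tau (inr p) @^-1` D =
    (A `&` act (letter_value p) @^-1` D) `|` (~` A `&` D).
  apply/seteqP; split=> x /=.
    by case: asboolP => Ax Dx; [left|right].
  by move=> [[Ax Dx]|[nA Dx]]; [rewrite asboolT|rewrite asboolF].
have mE : measurable (letter_map act A tau (inr p) @^-1` D).
  rewrite EP; apply: measurableU; apply: measurableI => //; first exact: cA.1.
  exact/measurableC/cA.1.
split=> //; rewrite -[RHS](action_preserving pa (letter_value p) mD).
by apply: (mass_eq_conull cA) => // x Ax /=; rewrite asboolT.
Qed.

End GeneratedMeasurability.
Arguments preserving {R d X} mu f.

(** A transformation is determined by any word that represents it. *)
Lemma countable_generated (X : Type) (G : groupType) (act : G -> X -> X)
    (A : set X) (B : set G) (b0 : G) (tau : nat -> X -> X)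
    (hH : transformation_group (generated_maps act A B b0 tau)) :
  countable [set: G] -> countable [set: transf_groupType hH].
Proof.
move=> /countable_injP[phi phi_inj].
pose code (l : letter (G := G)) : (nat * nat) + (nat * bool) :=
  match l with inl a => inl a | inr p => inr (phi p.1, p.2) end.
have code_inj : injective code.
  move=> [a|[b s]] [a'|[b' s']] //= []; first by move=> ->.
  by move=> e ->; rewrite (phi_inj b b') ?inE.
have wit (f : transf_groupType hH) : exists w, sval f = word_map act A tau w.
  by have [w _ fw] := svalP f; exists w.
have [wd wdE] := choice wit.
apply/countable_injP; exists (fun f => pickle (map code (wd f))).
move=> f g _ _ /(pcan_inj pickleK)/(inj_map code_inj) fg.
by apply: group_of_inj; rewrite !wdE fg.
Qed.

Section OrbitEquivalentGroup.
Context {R : realType} {Gamma : groupType} (Gamma_countable : countable [set: Gamma]).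
Context {B : set Gamma} (basis : free_basis B) {b0 : Gamma} (Bb0 : B b0).
Context {d : measure_display} {X : measurableType d} {mu : probability X R}.
Context {act : Gamma -> X -> X} (pa : probability_action mu act).

Local Notation sh := (fun k => act (zexp b0 k)).

Let act1 := action1 pa.
Let actM := actionM pa.

Lemma free_part : exists X0, [/\ conull mu X0, (forall g x, X0 x -> X0 (act g x)) &
  forall g x, X0 x -> act g x = x -> g = 1%g].
Proof.
have [Z [mZ Z0 ZP]] := action_ess_free pa.
have cZ : conull mu (~` Z) by split; [exact: measurableC|rewrite setCK].
exists [set x | forall g, (act g @^-1` (~` Z)) x]; split.
- by apply: conull_forall_countable => // g; exact: (conull_act pa).
- by move=> g x h k /=; rewrite -actM; exact: h.
- move=> g x h; have nZ := h 1%g; rewrite /= act1 in nZ.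
  by have : forall g, act g x = x -> g = 1%g; [apply: contrapT => /ZP|exact].
Qed.

(** The group acts on X itself and the orbit equivalence is the identity.  Orders of
rotations are products of powers of the multipliers, so that the multipliers
prescribe the torsion primes. *)
Lemma orbit_equivalent_group (m : nat -> nat) : (forall k, (1 < m k)%N) ->
  exists Lambda : groupType, [/\ countable [set: Lambda],
    (forall p, prime p -> torsion_prime Lambda p <-> exists k, (p %| m k)%N) &
    exists (d' : measure_display) (Y : measurableType d')
      (nu : probability Y R) (actY : Lambda -> Y -> Y),
      probability_action nu actY /\ orbit_equivalent mu nu act actY].
Proof.
move=> m1; have zsh := act_zaction pa b0.
have [X0 [cX0 iX0 fX0]] := free_part.
have [U [mU sepU]] := standard_borel_separating (action_standard pa).
have aX0 : ample mu sh X0 by split=> // i x; exact: iX0.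
have free x i : X0 x -> sh i x = x -> i = 0.
  by move=> Xx /(fX0 _ _ Xx); exact: (zexp_eq1 basis).
have [X1 [N [[aX1 X10] N0 NS rot]]] := zaction_rotations zsh mU sepU aX0 free m1.
(* X1 is only invariant under b0. *)
pose A : set X := [set x | forall g, (act g @^-1` X1) x].
have cA : conull mu A.
  by apply: conull_forall_countable => // g; apply: (conull_act pa); exact: aX1.1.
have iA g x : A x -> A (act g x) by move=> h k /=; rewrite -actM; exact: h.
have AX1 : A `<=` X1 by move=> x /(_ 1%g) /=; rewrite act1.
have [tau rs] := rot A cA.1 (fun i x => iA _ x) AX1.
have freeA g x : A x -> act g x = x -> g = 1%g by move=> /AX1/X10; exact: fX0.
have N_gt0 k : (0 < N k)%N.
  elim: k => [|k IH]; first by rewrite N0.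
  by have [t _ ->] := NS k; rewrite muln_gt0 IH andbT expn_gt0 (ltnW (m1 k)).
have out := rs_out rs; have orb := rs_orbit rs; have fixed := rs_fixed rs.
have pow := rs_power rs.
have trans x : A x -> exists k i, act b0 x = iter i (tau k) x := rs_transitive rs (x := x).
pose hH := generated_maps_group B b0 act1 actM iA out N_gt0 fixed.
have [x0 Ax0] : exists x, A x.
  apply: contrapT => /forallNP nA; have [_] := cA.
  rewrite (_ : ~` A = setT) ?probability_setT => [/eqP|].
    by rewrite onee_eq0.
  by apply/seteqP; split=> // x _; exact: nA.
exists (transf_groupType hH); split.
- exact: countable_generated.
- move=> p pp; rewrite -(dvd_orders pp N0 NS); split.
    move=> [[f [w wok fw]] [f1 fp]]; apply: contrapT => /forallNP pN; apply: f1.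
    apply: group_of_inj; apply/funext => x /=; rewrite fw.
    apply: (generated_torsion act1 actM iA freeA basis Bb0 out orb N_gt0 fixed pow _ pp pN wok).
      by exists x0.
    by move=> y; have := congr1 (fun g : transf_groupType hH => sval g y) fp; rewrite group_of_expE /= fw.
  move=> [k pk]; pose i := (N k %/ p)%N.
  have gen : generated_maps act A B b0 tau (iter i (tau k)).
    by exists [:: inl (k, i)] => // l [<-|].
  exists (exist _ _ gen : transf_groupType hH); split.
    move=> /(congr1 (fun g : transf_groupType hH => sval g x0)) /= /(fixed k i x0 Ax0).
    move=> /dvdn_leq; rewrite divn_gt0 ?prime_gt0// dvdn_leq// => /(_ isT).
    by rewrite leqNgt ltn_Pdiv ?prime_gt1.
  apply: group_of_inj; apply/funext => x; rewrite group_of_expE /=.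
  have iterM q : iter q (iter i (tau k)) x = iter (q * i) (tau k) x.
    by elim: q => [//|q IH]; rewrite mulSn iterD -IH.
  by rewrite iterM mulnC divnK//; exact: (iter_tau_id out fixed).
pose actY (f : transf_groupType hH) (x : X) : X := sval f x.
have pres (f : transf_groupType hH) : preserving mu (sval f).
  apply: (generated_preserving pa cA) (svalP f) => k D mD.
  by split; [exact: (rs_measurable rs)|exact: (rs_preserving rs)].
exists d, X, mu, actY; split.
  split=> //.
  - exact: (action_standard pa).
  - by move=> f _ D mD; rewrite setTI; have [] := pres f D mD.
  - by move=> f D mD; have [] := pres f D mD.
  - exists (~` A); split; [exact/measurableC/cA.1|exact: cA.2|].
    move=> x nP Ax; apply: nP => f fx; apply: group_of_inj.
    exact: (generated_map_free act1 actM iA freeA basis Bb0 out orb fixed pow (svalP f) Ax fx).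
exists id.
  exists setT, setT; rewrite setCT measure0; split=> //.
  - by split=> // x _; exists x.
  - by move=> D _ mD; rewrite setTI preimage_id.
  - by move=> D _ mD; rewrite image_id.
exists (~` A); split; [exact/measurableC/cA.1|exact: cA.2|].
move=> x nP Ax; apply: nP; rewrite /= image_id /action_orbit.
rewrite -(generated_orbit act1 actM iA basis out orb N_gt0 fixed trans Ax).
apply/seteqP; split=> y; first by move=> [f Hf <-]; exists (exist _ f Hf).
by move=> [f _ <-]; exists (sval f) => //; exact: (svalP f).
Qed.

End OrbitEquivalentGroup.

Theorem theorem2p27 (R : realType) (Gamma : groupType)
    (Gamma_countable : countable [set: Gamma])
    (Gamma_nontrivial : exists g : Gamma, g <> 1%g)
    (Gamma_free : free_group Gamma)
    (d : measure_display) (X : measurableType d) (mu : probability X R)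
    (act : Gamma -> X -> X) (act_prob : probability_action mu act) :
  exists (I : Type) (Lambda : I -> groupType),
    [/\ ~ countable [set: I],
        (forall i j : I, i <> j -> ~ group_isomorphic (Lambda i) (Lambda j)),
        (forall i : I, countable [set: Lambda i]) &
        (forall i : I,
           exists (d' : measure_display) (Y : measurableType d')
             (nu : probability Y R) (actY : Lambda i -> Y -> Y),
             probability_action nu actY /\
             orbit_equivalent mu nu act actY)].
Proof.
have [B basis] := Gamma_free; have [b0 Bb0] := free_basis_nonempty basis Gamma_nontrivial.
have [Lambda hL] := choice (fun S : nat -> bool =>
  orbit_equivalent_group Gamma_countable basis Bb0 act_prob (multiplier_gt1 S)).
exists (nat -> bool), Lambda; split.
- exact: nat_bool_uncountable.
- move=> S S' SS' iso; apply: SS'; apply/funext => n.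
  have tp T : torsion_prime (Lambda T) (nth_prime n.+1) <-> T n.
    have [_ h _] := hL T.
    by rewrite (h _ (nth_prime_prime _)); exact: dvd_multiplier.
  apply/idP/idP => /tp h; apply/tp.
    exact: torsion_prime_isomorphic iso h.
  exact: torsion_prime_isomorphic (group_isomorphic_sym iso) h.
- by move=> S; have [] := hL S.
- by move=> S; have [] := hL S.
Qed.
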